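(* For any integer $l\geq1$, there exists $f\in\mathcal{U}(\mathbb{D},\mathbb{T})$ such that the $l$-th derivative $f^{(l)}$ does not belong to $\mathcal{U}(\mathbb{D},\mathbb{T})$.
   Context: $\mathbb{D}$ is the open unit disc of $\mathbb{C}$, $\mathbb{T}$ the unit circle, $H(\mathbb{D})$ the space of holomorphic functions on $\mathbb{D}$. For $f=\sum_k a_kz^k\in H(\mathbb{D})$, $S_n(f)=\sum_{k=0}^n a_kz^k$. $\mathcal{U}(\mathbb{D},\mathbb{T})$ is the set of $f\in H(\mathbb{D})$ such that for every compact $K\subset\mathbb{T}$ with $K\neq\mathbb{T}$ and every continuous $\varphi:K\to\mathbb{C}$ there is an increasing sequence of integers $(\lambda_n)_n$ with $\sup_{\zeta\in K}|S_{\lambda_n}(f)(\zeta)-\varphi(\zeta)|\to0$ as $n\to\infty$. *)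

(* Defs.v *)
From HB Require Import structures.
From mathcomp Require Import all_boot all_order all_algebra.
From mathcomp Require Import all_classical all_reals all_analysis.
From mathcomp Require Import complex.

Set Implicit Arguments.
Unset Strict Implicit.
Unset Printing Implicit Defensive.

Import Order.TTheory GRing.Theory Num.Theory.
Import numFieldTopology.Exports numFieldNormedType.Exports.
Import Normc.

Local Open Scope classical_set_scope.
Local Open Scope ring_scope.
Local Open Scope complex_scope.

(* Norm topology of C = R[i]; scalars are C itself, so [derivable] and
   [derive1n] below are complex differentiation. *)
HB.instance Definition _ (R : rcfType) := NormedModule.copy R[i] R[i]^o.

Section Universal.
Context {R : realType}.
Notation C := R[i].

Definition unit_disc : set C := [set z | normc z < 1].
Definition unit_circle : set C := [set z | normc z = 1].

(* An element of H(D) is represented by a total function C -> C; only its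
   values on D matter (D is open, so this includes iterated derivatives). *)
Definition holomorphic_on_disc (f : C -> C) : Prop :=
  forall z, unit_disc z -> derivable f z 1.

Definition partial_sum (a : C ^nat) (n : nat) (z : C) : C :=
  \sum_(0 <= k < n.+1) a k * z ^+ k.

Definition power_expansion (f : C -> C) (a : C ^nat) : Prop :=
  forall z, unit_disc z -> partial_sum a ^~ z @ \oo --> f z.

(* [sup set0 = 0], so the case K = set0 is the trivial one. *)
Definition universal_series (a : C ^nat) : Prop :=
  forall (K : set C) (phi : C -> C),
    compact K -> K `<=` unit_circle -> K <> unit_circle ->
    {within K, continuous phi} ->
    exists2 lambda : nat -> nat,
      {homo lambda : m n / (m < n)%N} &
      (fun n => sup [set normc (partial_sum a (lambda n) zeta - phi zeta)
                    | zeta in K]) @ \oo --> (0 : R).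

(* The set U(D, T).  The coefficient sequence a is unique, since a convergent
   power series on D is determined by its sum. *)
Definition in_U (f : C -> C) : Prop :=
  holomorphic_on_disc f /\
  exists2 a : C ^nat, power_expansion f a & universal_series a.

End Universal.

(* Main.v *)
Require Import Defs.
From mathcomp Require Import all_boot all_order all_algebra.
From mathcomp Require Import all_classical all_reals all_analysis.
From mathcomp Require Import complex.
From mathcomp Require Import ring lra.

Set Implicit Arguments.
Unset Strict Implicit.
Unset Printing Implicit Defensive.

Import Order.TTheory GRing.Theory Num.Theory.
Import numFieldTopology.Exports numFieldNormedType.Exports.
Import Normc.

Local Open Scope classical_set_scope.
Local Open Scope ring_scope.
Local Open Scope complex_scope.

(** The function is [f(z) = \sum_k (a_k + c_k) z^k], where [\sum a_k z^k] is
    an arbitrary universal Taylor series and [\sum c_k z^k] converges absolutely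
    on the closed disc.

    Such a perturbation does not affect universality: the partial sums of
    [\sum c_k z^k] converge uniformly on the circle, so it suffices to shift the
    functions to be approximated ([universal_on_arcs_add]). It can nevertheless
    destroy the universality of the derivative. The partial sums at 1 of the
    series of [f^(l)] are the [T_n = \sum_(k <= n) k^_l (a_k + c_k)], where
    [k^_l >= k] for [k >= l >= 1]. Let the [c_k] be supported by the powers of 4.
    A coefficient of size at most about [2^-i] at [k = 4^i] translates the [T_n]
    with [n >= 4^i] by a vector which can be chosen at will in a square of side
    about [2^i]. There are fewer than [4^(i+1)] indices [n < 4^(i+1)], and each
    of them excludes only a disc of radius 1 of translations; a pigeonhole
    argument thus gives a translation after which [|T_n| >= 1] for all [n] with
    [4^i <= n < 4^(i+1)] ([avoid_finite], [avoid_zero]). Hence the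
    partial sums of [f^(l)] cannot tend to 0 on the compact set [{1}]
    ([not_universal_at1]).

    A universal series is built from polynomial blocks with disjoint spectra
    ([universal_on_arcs_exists]). A block has to be a polynomial of large
    valuation, small on a disc of radius [r < 1], and close to a given polynomial
    on a closed arc of the circle; multiplying by that polynomial reduces this to
    the constant 1 ([approx_one_on_arc]). The rational function
    [z^n / (z^n + rho^n)], with [r < rho < 1], is of this type for large [n]. Its
    poles have modulus [rho], and Runge's pole pushing moves them to infinity
    through the gap left by the arc ([approx_inv_pole]), so that it is a limit of
    polynomials divisible by [z^n]. Finally the polynomials are dense in the
    continuous functions on a proper compact subset of the circle
    ([poly_dense]): there [1/z] is a limit of polynomials, hence so are all the
    quotients of sums of a peaking kernel, which approximate any continuous
    function.

    The statements about [f^(l)] rest on the termwise differentiation of power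
    series ([power_series_derive]) and on the uniqueness of their coefficients
    ([power_expansion_unique]). *)

(** * The modulus on C *)

Section Modulus.
Variable R : realType.
Implicit Types (x y z : R[i]) (p q : {poly R[i]}).

Lemma normcD_le x y : normc (x + y) <= normc x + normc y.
Proof. exact: le_normcD. Qed.

Lemma normc_opp x : normc (- x) = normc x.
Proof. exact: normcN. Qed.

Lemma normcB_le x y : normc (x - y) <= normc x + normc y.
Proof. by rewrite -(normc_opp y) normcD_le. Qed.

Lemma normc_distC x y : normc (x - y) = normc (y - x).
Proof. by rewrite -normc_opp opprB. Qed.

Lemma normc_ge0 x : 0 <= normc x.
Proof. by case: x => a b; exact: sqrtr_ge0. Qed.

Lemma normcX x n : normc (x ^+ n) = normc x ^+ n.
Proof. by elim: n => [|n IH]; rewrite ?expr0 ?normc1 // !exprS normcM IH. Qed.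

Lemma normc_real (a : R) : normc a%:C = `|a|.
Proof. by rewrite /= expr0n /= addr0 sqrtr_sqr. Qed.

Lemma normc_nat n : normc (n%:R : R[i]) = n%:R.
Proof. by rewrite -(rmorph_nat (real_complex R)) normc_real normr_nat. Qed.

Lemma normc_sum (I : Type) (s : seq I) (P : pred I) (F : I -> R[i]) :
  normc (\sum_(i <- s | P i) F i) <= \sum_(i <- s | P i) normc (F i).
Proof.
elim/big_ind2 : _ => [|x a y b xa yb|//]; first by rewrite normc0.
exact: le_trans (normcD_le _ _) (lerD xa yb).
Qed.

Lemma normc_triangle x y z : normc (x - z) <= normc (x - y) + normc (y - z).
Proof. by rewrite -(subrKA y x); exact: normcD_le. Qed.

Lemma normcB_ge x y : normc x - normc y <= normc (x - y).
Proof. by have := normcD_le (x - y) y; rewrite subrK; lra. Qed.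

Lemma normcD_ge x y : normc x - normc y <= normc (x + y).
Proof. by have := normcB_ge x (- y); rewrite normc_opp opprK. Qed.

Lemma normc_gt0 x : (0 < normc x) = (x != 0).
Proof.
rewrite lt_def normc_ge0 andbT; congr (~~ _).
by apply/eqP/eqP => [/eq0_normc|->]; rewrite ?normc0.
Qed.

Lemma Re_le_normc x : `|complex.Re x| <= normc x.
Proof.
by case: x => a b /=; rewrite -sqrtr_sqr ler_wsqrtr // lerDl sqr_ge0.
Qed.

Lemma Im_le_normc x : `|complex.Im x| <= normc x.
Proof.
by case: x => a b /=; rewrite -sqrtr_sqr ler_wsqrtr // lerDr sqr_ge0.
Qed.

Lemma normc_le_ReIm x : normc x <= `|complex.Re x| + `|complex.Im x|.
Proof.
case: x => a b; rewrite [X in normc X]complexE.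
change (normc (a%:C + 'i * b%:C) <= `|a| + `|b|).
apply: le_trans (normcD_le _ _) _; rewrite normcM !normc_real.
by rewrite /normc /= expr0n expr1n /= add0r sqrtr1 mul1r.
Qed.

Lemma expr_small (q e : R) : 0 <= q < 1 -> 0 < e ->
  exists N : nat, forall n, (N <= n)%N -> q ^+ n <= e.
Proof.
move=> /andP[q0 q1] e0.
have : (fun n => q ^+ n) @ \oo --> (0 : R) by apply: cvg_expr; rewrite ger0_norm.
move/cvgrPdist_le => /(_ _ e0)[N _ hN]; exists N => n /hN /=.
by rewrite sub0r normrN ger0_norm // exprn_ge0.
Qed.

End Modulus.

(** * The Wiener norm of a polynomial on a disc *)

Section WienerNorm.
Variable R : realType.
Implicit Types (x y z : R[i]) (p q : {poly R[i]}) (r s : R).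

(** The polynomial whose coefficients are the moduli of those of [p]. *)
Definition abs_poly p : {poly R} := \poly_(i < size p) normc p`_i.

(** The Wiener norm [\sum_k |p_k| r^k], a submultiplicative norm which bounds
    [|p|] on the disc of radius [r]. *)
Definition wiener r p : R := (abs_poly p).[r].

Lemma coef_abs_poly p i : (abs_poly p)`_i = normc p`_i.
Proof.
by rewrite coef_poly; case: ltnP => // h; rewrite nth_default // normc0.
Qed.

Lemma size_abs_poly p : (size (abs_poly p) <= size p)%N.
Proof. exact: size_poly. Qed.

Lemma wiener_widen r p n : (size p <= n)%N ->
  wiener r p = \sum_(i < n) normc p`_i * r ^+ i.
Proof.
move=> pn; rewrite /wiener (@horner_coef_wide _ n); last first.
  exact: leq_trans (size_abs_poly _) pn.
by apply: eq_bigr => i _; rewrite coef_abs_poly.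
Qed.

Lemma wiener_ge0 r p : 0 <= r -> 0 <= wiener r p.
Proof.
move=> r0; rewrite (wiener_widen r (leqnn _)).
by apply: sumr_ge0 => i _; rewrite mulr_ge0 ?normc_ge0 ?exprn_ge0.
Qed.

Lemma wiener_add r p q : 0 <= r -> wiener r (p + q) <= wiener r p + wiener r q.
Proof.
move=> r0; set n := maxn (size p) (size q).
rewrite !(@wiener_widen r _ n) ?leq_maxl ?leq_maxr ?size_polyD //.
rewrite -big_split /=; apply: ler_sum => i _.
by rewrite coefD -mulrDl ler_wpM2r ?exprn_ge0 ?normcD_le.
Qed.

Lemma wiener_opp r p : wiener r (- p) = wiener r p.
Proof.
congr _.[_]; apply/polyP => i.
by rewrite !coef_abs_poly coefN normc_opp.
Qed.

Lemma wienerZ r (c : R[i]) p : wiener r (c *: p) = normc c * wiener r p.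
Proof.
rewrite /wiener -hornerZ; congr _.[_]; apply/polyP => i.
by rewrite coefZ !coef_abs_poly coefZ normcM.
Qed.

Lemma wienerC r (c : R[i]) : wiener r c%:P = normc c.
Proof.
rewrite /wiener -[RHS](hornerC _ r); congr _.[_]; apply/polyP => i.
by rewrite coef_abs_poly !coefC; case: eqP; rewrite ?normc0.
Qed.

Lemma wiener0 r : wiener r 0 = 0.
Proof. by rewrite wienerC normc0. Qed.

Lemma wiener1 r : wiener r 1 = 1.
Proof. by rewrite wienerC normc1. Qed.

Lemma wienerMXaddC r p (c : R[i]) :
  wiener r (p * 'X + c%:P) = wiener r p * r + normc c.
Proof.
rewrite /wiener -[RHS](hornerMXaddC _ _ r); congr _.[_]; apply/polyP => i.
rewrite coef_abs_poly !coefD !coefMX !coefC.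
by case: i => [|i] /=; rewrite ?add0r ?addr0 // coef_abs_poly.
Qed.

Lemma wienerMX r p : wiener r (p * 'X) = wiener r p * r.
Proof. by have := wienerMXaddC r p 0; rewrite addr0 normc0 addr0. Qed.

Lemma wienerMXn r p n : wiener r (p * 'X^n) = wiener r p * r ^+ n.
Proof.
elim: n => [|n IH]; first by rewrite !expr0 !mulr1.
by rewrite !exprSr !mulrA wienerMX IH.
Qed.

Lemma wienerM r p q : 0 <= r -> wiener r (p * q) <= wiener r p * wiener r q.
Proof.
move=> r0; elim/poly_ind: p => [|p c IH]; first by rewrite mul0r wiener0 mul0r.
rewrite wienerMXaddC mulrDl mulrAC.
apply: le_trans (wiener_add _ _ r0) _.
rewrite wienerMX mul_polyC wienerZ mulrDl lerD2r mulrAC.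
by rewrite ler_wpM2r.
Qed.

Lemma le_wiener r s p : 0 <= r <= s -> wiener r p <= wiener s p.
Proof.
case/andP=> r0 rs; rewrite !(wiener_widen _ (leqnn _)).
apply: ler_sum => i _; rewrite ler_wpM2l ?normc_ge0 //.
by rewrite lerXn2r ?nnegrE // (le_trans r0).
Qed.

Lemma normc_horner p z : normc p.[z] <= wiener (normc z) p.
Proof.
rewrite horner_coef (wiener_widen _ (leqnn _)).
apply: le_trans (normc_sum _ _ _) _.
by apply: ler_sum => i _; rewrite normcM normcX.
Qed.

End WienerNorm.

(** * Polynomials close to 1 on an arc and to 0 on a disc *)

Section ApproxInverse.
Variables (R : realType) (E : set R[i]) (r : R).
Hypotheses (E_circle : E `<=` unit_circle) (r_ge0 : 0 <= r).
Implicit Types (z w : R[i]) (p q b L : {poly R[i]}).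

(** [poly_bound p c] says that [p] has norm at most [c] in the algebra of
    polynomials normed by the maximum of the supremum on [E] and of the Wiener
    norm on the disc of radius [r]. *)
Definition poly_bound p (c : R) : Prop :=
  (forall z, E z -> normc p.[z] <= c) /\ wiener r p <= c.

(** [b] is invertible in the completion of that normed algebra. *)
Definition approx_inv b : Prop :=
  forall e, 0 < e -> exists L, poly_bound (b * L - 1) e.

Lemma poly_bound_le p c d : poly_bound p c -> c <= d -> poly_bound p d.
Proof.
by move=> [h1 h2] cd; split=> [z Ez|]; apply: le_trans cd => //; exact: h1.
Qed.

Lemma poly_bound1 : poly_bound 1 1.
Proof. by split=> [z _|]; rewrite ?hornerC ?normc1 ?wiener1. Qed.

Lemma poly_boundD p q c d :
  poly_bound p c -> poly_bound q d -> poly_bound (p + q) (c + d).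
Proof.
move=> [p1 p2] [q1 q2]; split=> [z Ez|].
  by rewrite hornerD (le_trans (normcD_le _ _))// lerD ?p1 ?q1.
by rewrite (le_trans (wiener_add _ _ r_ge0))// lerD.
Qed.

Lemma poly_boundN p c : poly_bound p c -> poly_bound (- p) c.
Proof.
move=> [h1 h2]; split=> [z Ez|]; last by rewrite wiener_opp.
by rewrite hornerN normc_opp h1.
Qed.

Lemma poly_boundM p q c d :
  poly_bound p c -> poly_bound q d -> poly_bound (p * q) (c * d).
Proof.
move=> [p1 p2] [q1 q2]; split=> [z Ez|].
  by rewrite hornerM normcM ler_pM ?normc_ge0 ?p1 ?q1.
by rewrite (le_trans (wienerM _ _ r_ge0))// ler_pM ?wiener_ge0.
Qed.

Lemma poly_boundC (a : R[i]) : poly_bound a%:P (normc a).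
Proof. by split=> [z _|]; rewrite ?hornerC ?wienerC. Qed.

Lemma poly_boundX p c n : poly_bound p c -> poly_bound (p ^+ n) (c ^+ n).
Proof.
move=> h; elim: n => [|n IH]; first by rewrite !expr0; exact: poly_bound1.
by rewrite !exprS; exact: poly_boundM.
Qed.

Lemma geometric_inverse q n : poly_bound q (1 / 2) ->
  exists2 g, (1 - q) * g = 1 - q ^+ n & poly_bound g 2.
Proof.
move=> hq; elim: n => [|n [g eg hg]].
  exists 0; first by rewrite mulr0 expr0 subrr.
  by split=> [z _|]; rewrite ?horner0 ?normc0 ?wiener0 //; lra.
exists (1 + q * g).
  by rewrite mulrDr mulr1 mulrCA eg exprS; ring.
apply: (poly_bound_le (poly_boundD poly_bound1 (poly_boundM hq hg))); lra.
Qed.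

Lemma exp_half_small (e : R) : 0 < e -> exists n : nat, (1 / 2) ^+ n <= e.
Proof.
have h : 0 <= (1 / 2 : R) < 1 by lra.
by move=> /(expr_small h)[n hn]; exists n; exact: hn.
Qed.
Lemma approx_inv1B q : poly_bound q (1 / 2) -> approx_inv (1 - q).
Proof.
move=> hq e /exp_half_small[n hn].
have [g eg _] := geometric_inverse n hq; exists g.
rewrite eg addrAC subrr add0r; apply: poly_boundN.
exact: poly_bound_le (poly_boundX _ hq) hn.
Qed.

Lemma approx_invC (a : R[i]) : a != 0 -> approx_inv a%:P.
Proof.
move=> a0 e e0; exists a^-1%:P; rewrite -polyCM mulfV // subrr.
by split=> [z _|]; rewrite ?horner0 ?normc0 ?wiener0 // ltW.
Qed.

Lemma approx_invM b b' : approx_inv b -> approx_inv b' -> approx_inv (b * b').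
Proof.
move=> hb hb' e e0; have h0 : 0 < Num.min 1 (e / 3).
  by rewrite lt_min; apply/andP; split; lra.
have [L hL] := hb _ h0; have [L' hL'] := hb' _ h0; exists (L * L').
have -> : b * b' * (L * L') - 1 = ((b * L - 1) + 1) * (b' * L' - 1) + (b * L - 1).
  by ring.
apply: (poly_bound_le (poly_boundD
  (poly_boundM (poly_boundD hL poly_bound1) hL') hL)).
move: h0; set m := Num.min _ _ => m0.
have m1 : m <= 1 by rewrite ge_min lexx.
have m2 : m <= e / 3 by rewrite ge_min lexx orbT.
have : m * m <= m * 1 by rewrite ler_wpM2l // ltW.
by lra.
Qed.

(** Openness of the set of invertible elements, by a Neumann series; the bound
    from below on [b] controls the norm of its approximate inverses. *)
Lemma approx_inv_perturb b (eta : R) (c : R[i]) : 0 < eta ->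
  (forall p d, poly_bound (b * p) d -> poly_bound p (d / eta)) ->
  normc c <= eta / 4 -> approx_inv b -> approx_inv (b - c%:P).
Proof.
move=> eta0 low hc hb e e0.
have h0 : 0 < Num.min 1 (e / 4) by rewrite lt_min; apply/andP; split; lra.
have [L hL] := hb _ h0.
move: h0 hL; set m := Num.min _ _ => m0 hL.
have m1 : m <= 1 by rewrite ge_min lexx.
have m2 : m <= e / 4 by rewrite ge_min lexx orbT.
have hbL : poly_bound L (2 / eta).
  apply: low; rewrite -(subrK 1 (b * L)).
  by apply: (poly_bound_le (poly_boundD hL poly_bound1)); lra.
have hq : poly_bound (c%:P * L) (1 / 2).
  apply: poly_bound_le (poly_boundM (poly_boundC c) hbL) _.
  have := ler_wpM2r (ltW (divr_gt0 (ltr0n R 2) eta0)) hc.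
  suff -> : eta / 4 * (2 / eta) = 1 / 2 by [].
  by field; rewrite gt_eqF.
have e2 : 0 < e / 2 by lra.
have [n hn] := exp_half_small e2.
have [g eg hg] := geometric_inverse n hq.
exists (L * g).
have -> : (b - c%:P) * (L * g) - 1 =
    (b * L - 1) * g + ((1 - c%:P * L) * g - 1) by ring.
rewrite eg addrAC subrr add0r.
apply: (poly_bound_le (poly_boundD (poly_boundM hL hg)
  (poly_boundN (poly_boundX n hq)))).
by lra.
Qed.

(** The pole [w] is at distance at least [eta] from [E] and from the disc. *)
Definition safe_pole (eta : R) w : Prop :=
  eta <= normc w - r /\ forall z, E z -> eta <= normc (z - w).

Lemma safe_pole_low (eta : R) w p d : 0 < eta -> safe_pole eta w ->
  poly_bound (('X - w%:P) * p) d -> poly_bound p (d / eta).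
Proof.
move=> eta0 [w1 w2] [h1 h2]; split=> [z Ez|].
  rewrite ler_pdivlMr //; apply: le_trans (h1 _ Ez).
  rewrite hornerM !hornerE normcM mulrC.
  by rewrite ler_wpM2r ?normc_ge0 ?w2.
rewrite ler_pdivlMr //; apply: le_trans h2.
have -> : ('X - w%:P) * p = p * 'X - w *: p.
  by rewrite -mul_polyC; ring.
have := wiener_add (p * 'X - w *: p) (- (p * 'X)) r_ge0.
rewrite addrAC subrr add0r !wiener_opp wienerMX wienerZ.
have := ler_wpM2l (wiener_ge0 p r_ge0) w1.
by lra.
Qed.

(** Runge's pole pushing along a chain of poles with small steps. *)
Lemma approx_inv_chain (eta : R) (f : nat -> R[i]) n : 0 < eta ->
  (forall k, (k <= n)%N -> safe_pole eta (f k)) ->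
  (forall k, (k < n)%N -> normc (f k.+1 - f k) <= eta / 4) ->
  approx_inv ('X - (f 0%N)%:P) -> approx_inv ('X - (f n)%:P).
Proof.
move=> eta0; elim: n => [//|n IH] hs hf h0.
have -> : 'X - (f n.+1)%:P = 'X - (f n)%:P - (f n.+1 - f n)%:P :> {poly R[i]}.
  by rewrite polyCB; ring.
apply: (@approx_inv_perturb _ eta) => //; last first.
- by apply: IH => // k kn; [apply: hs|apply: hf]; rewrite ltnW.
- exact: hf.
- by move=> p d; apply: safe_pole_low => //; apply: hs.
Qed.

Lemma approx_inv_far w : normc w = 3 -> r < 1 -> approx_inv ('X - w%:P).
Proof.
move=> w3 r1; have w0 : w != 0 by rewrite -normc_gt0 w3.
have -> : 'X - w%:P = (- w)%:P * (1 - (w^-1)%:P * 'X).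
  rewrite mulrBr mulr1 polyCN mulrA mulNr -polyCM mulfV //.
  by rewrite mulNr mul1r opprK addrC.
apply: approx_invM; first by apply: approx_invC; rewrite oppr_eq0.
apply: approx_inv1B; split=> [z /E_circle hz|].
  by rewrite hornerM !hornerE normcM normcV w3 hz; lra.
rewrite wienerMX wienerC normcV w3; lra.
Qed.

End ApproxInverse.

Section ArcApproximation.
Variable R : realType.
Implicit Types (z w u zeta : R[i]) (d r rho e : R).

(** The closed arc of the unit circle at distance at least [d] from [zeta]. *)
Definition arc zeta d : set R[i] :=
  [set z | normc z = 1 /\ d <= normc (z - zeta)].

Lemma normc_sqr z : normc z ^+ 2 = complex.Re z ^+ 2 + complex.Im z ^+ 2.
Proof. by case: z => a b /=; rewrite sqr_sqrtr // addr_ge0 ?sqr_ge0. Qed.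

Lemma unit_sqrt u : normc u = 1 -> exists c,
  [/\ c ^+ 2 = u, normc c = 1 & 2 * normc (c - 1) ^+ 2 <= normc (u - 1) ^+ 2].
Proof.
move=> u1.
have [c [c2 cRe]] : exists c : R[i], c ^+ 2 = u /\ 0 <= complex.Re c.
  have h : sqrtC u ^+ 2 = u by rewrite sqrtCK.
  case: (leP 0 (complex.Re (sqrtC u))) => hs; first by exists (sqrtC u).
  exists (- sqrtC u); rewrite sqrrN; split => //.
  by case: (sqrtC u) hs => a b /= a0; lra.
have c1 : normc c = 1.
  apply/eqP; rewrite -(@eqrXn2 _ 2) ?normc_ge0 //.
  by rewrite -normcX c2 u1 expr1n.
exists c; split=> //.
have -> : u - 1 = (c - 1) * (c + 1) by rewrite -c2; ring.
rewrite normcM exprMn mulrC ler_wpM2l ?sqr_ge0 // normc_sqr.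
have := normc_sqr c; rewrite c1.
case: c cRe {c2 c1} => a b /= a0; rewrite addr0; nra.
Qed.

(** Every point of the circle is a power of a point of the circle arbitrarily
    close to 1, namely an iterated square root. *)
Lemma unit_root_close u e : normc u = 1 -> 0 < e -> exists c n,
  [/\ c ^+ n = u, normc c = 1 & normc (c - 1) <= e].
Proof.
move=> u1 e0.
have H k : exists c n, [/\ c ^+ n = u, normc c = 1 &
    2 ^+ k * normc (c - 1) ^+ 2 <= 4].
  elim: k => [|k [c [n [cn c1 hc]]]].
    exists u, 1%N; split=> //; rewrite expr0 mul1r.
    have := normcB_le u 1; rewrite u1 normc1 => h.
    have := normc_ge0 (u - 1); nra.
  have [c' [c2 c'1 hc']] := unit_sqrt c1.
  exists c', (2 * n)%N; split=> //; first by rewrite exprM c2.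
  apply: le_trans hc; rewrite exprSr -mulrA ler_wpM2l ?exprn_ge0 //.
have he : 0 < e ^+ 2 / 4 by rewrite divr_gt0 ?exprn_gt0.
have h2 : 0 <= (1 / 2 : R) < 1 by lra.
have [N hN] := expr_small h2 he.
have [c [n [cn c1 hc]]] := H N; exists c, n; split=> //.
rewrite -(@ler_pXn2r _ 2) ?nnegrE ?normc_ge0 ?(ltW e0) //.
have := hN _ (leqnn N); rewrite expr_div_n expr1n => h.
have t0 : 0 < 2 ^+ N :> R by rewrite exprn_gt0.
move: h; rewrite ler_pdivrMr // => h.
rewrite -(ler_pM2l t0); lra.
Qed.

Lemma dist_radial z zeta (t : R) : normc zeta = 1 -> normc z = 1 ->
  0 <= t -> normc (z - zeta) <= 2 * normc (z - t%:C * zeta).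
Proof.
move=> zeta1 z1 t0.
have h1 := normc_triangle z (t%:C * zeta) zeta.
have : normc (t%:C * zeta - zeta) = `|t - 1|.
  rewrite -[X in _ - X]mul1r -mulrBl normcM zeta1 mulr1.
  by rewrite -normc_real rmorphB.
have h2 := normcB_ge z (t%:C * zeta).
have h3 := normcB_ge (t%:C * zeta) z.
move: h2 h3; rewrite (normc_distC _ z) normcM zeta1 z1 normc_real ger0_norm //.
by case: (ger0P (t - 1)); lra.
Qed.

(** The poles on the circle of radius [rho] are pushed to infinity by a
    rotation followed by a radial escape through the gap around [zeta]. *)
Lemma approx_inv_pole zeta d r rho w : normc zeta = 1 -> 0 < d ->
  0 <= r < rho -> rho < 1 -> normc w = rho ->
  approx_inv (arc zeta d) r ('X - w%:P).
Proof.
move=> zeta1 d0 /andP[r0 rrho] rho1 wrho.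
have rho0 : 0 < rho by exact: le_lt_trans rrho.
pose eta := Num.min (Num.min (rho - r) (1 - rho)) (d / 2).
have eta0 : 0 < eta by rewrite !lt_min; apply/andP; split; [apply/andP; split|]; lra.
have [eta1 eta2 eta3] : [/\ eta <= rho - r, eta <= 1 - rho & eta <= d / 2].
  by rewrite /eta; split; rewrite !ge_min lexx ?orbT.
have E_circle : arc zeta d `<=` unit_circle by move=> z [].
have rho_unit (t : R) u : 0 <= t -> normc u = 1 -> normc (t%:C * u) = t.
  by move=> t0 u1; rewrite normcM u1 normc_real mulr1 ger0_norm.
(* the radial part, from the modulus 3 to the modulus rho *)
have hrad : approx_inv (arc zeta d) r ('X - (rho%:C * zeta)%:P).
  have [n hn] : exists n : nat, 12 / eta <= n%:R.
    by exists (Num.bound (12 / eta)); rewrite ltW // archi_boundP // ltW // divr_gt0.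
  have n0 : 0 < n%:R :> R by apply: lt_le_trans hn; rewrite divr_gt0.
  pose t (k : nat) : R := 3 - (3 - rho) * (k%:R / n%:R).
  pose f (k : nat) := (t k)%:C * zeta.
  have tE k : (k <= n)%N -> rho <= t k.
    move=> kn; have kn1 : k%:R / n%:R <= 1 :> R.
      by rewrite ler_pdivrMr // mul1r ler_nat.
    have : (3 - rho) * (k%:R / n%:R) <= (3 - rho) * 1 by apply: ler_wpM2l; lra.
    by rewrite /t; lra.
  have -> : rho%:C * zeta = f n by rewrite /f /t divff ?gt_eqF // mulr1 subKr.
  apply: (approx_inv_chain r0 eta0) => [k kn|k kn|].
  - have t0 : 0 <= t k by apply: le_trans (tE _ kn); exact: ltW.
    split=> [|z [z1 zd]]; first by rewrite rho_unit //; have := tE _ kn; lra.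
    by have := dist_radial zeta1 z1 t0; rewrite -/(f k); lra.
  - rewrite /f -mulrBl -rmorphB normcM zeta1 mulr1 normc_real.
    have -> : t k.+1 - t k = - ((3 - rho) / n%:R).
      by rewrite /t -[k.+1%:R]natr1; field; rewrite gt_eqF.
    rewrite normrN ger0_norm ?divr_ge0 ?ler0n //; last lra.
    rewrite ler_pdivrMr //; move: hn; rewrite ler_pdivrMr // => hn.
    by lra.
  - apply: (approx_inv_far E_circle r0); last exact: lt_trans rho1.
    by rewrite rho_unit // /t mul0r mulr0 subr0.
(* the rotation *)
have u1 : normc (w / (rho%:C * zeta)) = 1.
  by rewrite normcM normcV rho_unit ?(ltW rho0) // wrho divff // gt_eqF.
have e40 : 0 < eta / 4 by lra.
have [c [n [cn c1 hc]]] := unit_root_close u1 e40.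
have z0 : rho%:C * zeta != 0 by rewrite -normc_gt0 rho_unit // ltW.
pose f k := rho%:C * zeta * c ^+ k.
have fE k : normc (f k) = rho.
  by rewrite /f normcM normcX c1 expr1n mulr1 rho_unit // ltW.
have -> : w = f n by rewrite /f cn mulrC mulfVK.
apply: (approx_inv_chain r0 eta0) => [k _|k _|]; last by rewrite /f expr0 mulr1.
- split=> [|z [z1 _]]; first by rewrite fE.
  by have := normcB_ge z (f k); rewrite fE z1; lra.
- have -> : f k.+1 - f k = f k * (c - 1) by rewrite /f exprSr; ring.
  rewrite normcM fE; apply: le_trans hc.
  by rewrite -[leRHS]mul1r ler_wpM2r ?normc_ge0 // ltW.
Qed.

Lemma approx_inv_Xn_add zeta d r rho n : normc zeta = 1 -> 0 < d ->
  0 <= r < rho -> rho < 1 -> (0 < n)%N ->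
  approx_inv (arc zeta d) r ('X^n + (rho ^+ n)%:C%:P).
Proof.
move=> zeta1 d0 hr rho1 n0.
have rho0 : 0 <= rho by case/andP: hr => h1 /ltW; exact: le_trans.
set P := 'X^n + _.
have Pmonic : P \is monic by exact: monicXnaddC.
have [s hs] := closed_field_poly_normal P.
rewrite (monicP Pmonic) scale1r in hs.
rewrite hs big_seq; elim/big_ind : _.
- by apply: approx_invC; rewrite oner_eq0.
- by move=> p q; apply: approx_invM; case/andP: hr.
- move=> w ws; apply: (approx_inv_pole (rho := rho)) => //.
  have : root P w by rewrite hs root_prod_XsubC.
  rewrite /root /P !hornerE addr_eq0 => /eqP /(congr1 (@normc R)).
  rewrite normcX normc_opp normc_real ger0_norm ?exprn_ge0 // => /eqP.
  by rewrite eqrXn2 ?normc_ge0 // => /eqP.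
Qed.

(** The function [z^n / (z^n + rho^n)], with [r < rho < 1], tends to 1 on the
    circle and to 0 on the disc of radius [r]. *)
Lemma approx_one_on_arc zeta d r e M : normc zeta = 1 -> 0 < d ->
  0 <= r < 1 -> 0 < e -> exists L : {poly R[i]},
  (forall z, arc zeta d z -> normc ((L * 'X^M).[z] - 1) <= e) /\
  wiener r (L * 'X^M) <= e.
Proof.
move=> zeta1 d0 /andP[r0 r1] e0.
pose rho := (1 + r) / 2.
have [rrho rho1] : r < rho /\ rho < 1 by rewrite /rho; split; lra.
have rho0 : 0 < rho by exact: le_lt_trans rrho.
pose m := Num.min (1 / 2) (e / 8).
have m0 : 0 < m by rewrite lt_min; apply/andP; split; lra.
have [m1 m2] : m <= 1 / 2 /\ m <= e / 8.
  by rewrite /m; split; rewrite !ge_min lexx ?orbT.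
have rho01 : 0 <= rho < 1 by rewrite ltW.
have [N1 hN1] := expr_small rho01 m0.
have q01 : 0 <= r / rho < 1.
  by rewrite divr_ge0 ?(ltW rho0) //= ltr_pdivrMr // mul1r.
have [N2 hN2] := expr_small q01 m0.
pose n := (N1 + N2 + M).+1.
(* the first bound is used on the circle, the second one on the disc *)
have hrho : rho ^+ n <= m by apply: hN1; rewrite leqW // -addnA leq_addr.
have hrr : r ^+ n <= m * rho ^+ n.
  rewrite -ler_pdivrMr ?exprn_gt0 // -expr_div_n.
  by apply: hN2; rewrite leqW // -addnA addnCA leq_addr.
have rn0 : 0 < rho ^+ n by rewrite exprn_gt0.
have r'0 : 0 <= r ^+ n by rewrite exprn_ge0.
have hr : 0 <= r < rho by rewrite r0.
have [L [L1 L2]] := approx_inv_Xn_add zeta1 d0 hr rho1 (ltn0Sn (N1 + N2 + M)) m0.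
rewrite -/n in L1 L2.
exists (L * 'X^(n - M)); rewrite -mulrA -exprD subnK; last first.
  by rewrite leqW // leq_addl.
have nrho : normc ((rho ^+ n)%:C : R[i]) = rho ^+ n.
  by rewrite normc_real ger0_norm // ltW.
split=> [z Ez|].
  have z1 : normc z = 1 by case: Ez.
  have hz := L1 _ Ez; rewrite !hornerE in hz; rewrite !hornerE.
  set l := L.[z] in hz *.
  have l4 : normc l * (1 - rho ^+ n) <= 1 + m.
    have h1 := normcD_ge ((z ^+ n + (rho ^+ n)%:C) * l) (-1).
    rewrite normc_opp normc1 normcM in h1.
    have h2 := normcD_ge (z ^+ n) (rho ^+ n)%:C.
    rewrite normcX z1 expr1n nrho in h2.
    have := ler_wpM2r (normc_ge0 l) h2; lra.
  have l3 : normc l <= 3.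
    have := ler_wpM2l (normc_ge0 l) (le_trans hrho m1); lra.
  have -> : l * z ^+ n - 1 = ((z ^+ n + (rho ^+ n)%:C) * l - 1) - (rho ^+ n)%:C * l.
    by ring.
  apply: le_trans (normcB_le _ _) _; rewrite normcM nrho.
  have := ler_pM (ltW rn0) (normc_ge0 l) hrho l3; lra.
have hL : wiener r L * (rho ^+ n - r ^+ n) <= 1 + m.
  have eL : (rho ^+ n)%:C *: L = ('X^n + (rho ^+ n)%:C%:P) * L - 1 + (1 - L * 'X^n).
    by rewrite -mul_polyC; ring.
  have := wiener_add (('X^n + (rho ^+ n)%:C%:P) * L - 1) (1 - L * 'X^n) r0.
  have := wiener_add 1 (- (L * 'X^n)) r0.
  rewrite -eL wienerZ nrho wiener_opp wienerMXn wiener1; lra.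
have W0 := wiener_ge0 L r0.
have h3 : wiener r L * rho ^+ n <= 3.
  have := ler_wpM2l W0 (le_trans hrr (ler_wpM2r (ltW rn0) m1)); lra.
rewrite wienerMXn.
have := ler_wpM2l W0 hrr.
have := ler_wpM2l (ltW m0) h3; lra.
Qed.

End ArcApproximation.

(** * Compact subsets of the circle *)

Section CompactSets.
Variable R : realType.
Implicit Types (z w x : R[i]) (K A : set R[i]) (phi : R[i] -> R[i]) (e d : R).

Lemma normc_ltP z (e : R[i]) : 0 < e ->
  (`|z| < e) = (normc z < complex.Re e).
Proof.
by case: e => a b; rewrite !ltcE /= => /andP[-> _].
Qed.

Lemma nbhs_normcP x A : nbhs x A <->
  exists2 e, 0 < e & forall w, normc (x - w) < e -> A w.
Proof.
split=> [|[e e0 h]].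
  rewrite -(@nbhs_ballE R[i]) => -[e /= e0 h]; exists (complex.Re e).
    by move: e0; rewrite ltcE => /andP[].
  by move=> w hw; apply: h; rewrite -ball_normE /ball_ /= normc_ltP.
rewrite -(@nbhs_ballE R[i]); exists e%:C; first by rewrite /= ltcR.
move=> w; rewrite -ball_normE /ball_ /= normc_ltP ?ltcR //; exact: h.
Qed.

Lemma compact_net K e : compact K -> 0 < e ->
  exists s : seq R[i], (forall x, x \in s -> K x) /\
    forall z, K z -> exists2 x, x \in s & normc (z - x) < e.
Proof.
move=> cK e0; rewrite compact_cover in cK.
pose f x : set R[i] := interior [set w | normc (x - w) < e].
have [] := cK _ K f.
- by move=> i _; exact: open_interior.
- move=> z Kz; exists z => //; apply/nbhs_normcP; exists e => //.
- move=> D DK hD; exists (finmap.enum_fset D); split=> [x xD|z /hD[x xD hx]].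
    by apply/set_mem/DK.
  exists x => //; rewrite normc_distC.
  by have := interior_subset hx.
Qed.

Lemma compact_unif_continuous K phi e : compact K ->
  {within K, continuous phi} -> 0 < e ->
  exists2 d, 0 < d & forall z w, K z -> K w -> normc (z - w) < d ->
    normc (phi z - phi w) <= e.
Proof.
move=> cK /subspace_continuousP cphi e0.
have loc x : K x -> exists2 d, 0 < d &
    forall w, K w -> normc (x - w) < d -> normc (phi x - phi w) <= e / 2.
  move=> Kx; have : nbhs (phi x) [set w | normc (phi x - w) <= e / 2].
    by apply/nbhs_normcP; exists (e / 2) => [|w /ltW //]; lra.
  move/(cphi _ Kx); rewrite nbhs_simpl /= => /nbhs_normcP[d d0 hd].
  by exists d => // w Kw hw; exact: hd.
have /compact_near_coveringP cov := cK.
pose P (d : R) z := forall w, K z -> K w -> normc (z - w) < d ->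
  normc (phi z - phi w) <= e.
have hP : \forall t \near 0^'+, K `<=` P t.
  apply: cov => x Kx; have [d d0 hd] := loc x Kx.
  exists ([set x' | normc (x - x') < d / 2], [set t | t < d / 2]).
    split; last by apply: nbhs_right_lt; lra.
    by apply/nbhs_normcP; exists (d / 2) => //; lra.
  move=> [z t] /= [hz ht] w Kz Kw hw.
  apply: le_trans (normc_triangle _ (phi x) _) _; rewrite (normc_distC (phi z)).
  have h1 := normc_triangle x z w.
  have h2 := hd z Kz; have h3 := hd w Kw.
  apply: le_trans (lerD (h2 _) (h3 _)) _; lra.
have [d [d0 hd]] := filter_ex (filterI (nbhs_right_gt (0 : R)) hP).
by exists d => // z w Kz Kw; exact: hd.
Qed.

Lemma compact_proper_arc K : compact K -> K `<=` unit_circle ->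
  K <> unit_circle -> exists zeta d, [/\ normc zeta = 1, 0 < d & K `<=` arc zeta d].
Proof.
move=> cK KT KnT.
have [zeta [z1 nK]] : exists zeta, normc zeta = 1 /\ ~ K zeta.
  apply: contrapT => h; apply: KnT; apply/seteqP; split=> // z z1.
  by apply: contrapT => nK; apply: h; exists z.
have clK : closed K by apply: compact_closed => //; exact: norm_hausdorff.
have : nbhs zeta (~` K) by apply: open_nbhs_nbhs; split=> //; exact: closed_openC.
move=> /nbhs_normcP[d d0 hd]; exists zeta, d; split=> // z Kz; split.
  exact: KT.
rewrite leNgt; apply/negP => hz; apply: (hd z) => //.
by rewrite normc_distC.
Qed.

End CompactSets.

(** * Density of the polynomials on proper compact subsets of the circle *)

Section Density.
Variables (R : realType) (K : set R[i]).
Hypothesis K_circle : K `<=` unit_circle.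
Implicit Types (z w x : R[i]) (g h : R[i] -> R[i]) (p : {poly R[i]}) (e : R).

(** [g] is a uniform limit of polynomials on [K]. *)
Definition poly_limit g : Prop := forall e, 0 < e ->
  exists p : {poly R[i]}, forall z, K z -> normc (p.[z] - g z) <= e.

Lemma poly_limit_horner p : poly_limit (horner p).
Proof. by move=> e e0; exists p => z _; rewrite subrr normc0 ltW. Qed.

Lemma poly_limit_cst (a : R[i]) : poly_limit (fun=> a).
Proof. by move=> e e0; exists a%:P => z _; rewrite hornerC subrr normc0 ltW. Qed.

Lemma eq_poly_limit g h : (forall z, K z -> g z = h z) ->
  poly_limit g -> poly_limit h.
Proof. by move=> gh hg e /hg[p hp]; exists p => z Kz; rewrite -gh ?hp. Qed.

Lemma poly_limit_bounded g : poly_limit g ->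
  exists2 B, 0 < B & forall z, K z -> normc (g z) <= B.
Proof.
move=> /(_ 1 ltr01)[p hp]; exists (wiener 1 p + 1).
  by have := wiener_ge0 p (@ler01 R); lra.
move=> z Kz; have := hp _ Kz; have := normc_horner p z.
have -> : normc z = 1 by exact: K_circle.
have := normcB_ge (g z) p.[z]; rewrite normc_distC; lra.
Qed.

Lemma poly_limit_lim g : (forall e, 0 < e -> exists2 h, poly_limit h &
  forall z, K z -> normc (h z - g z) <= e) -> poly_limit g.
Proof.
move=> hg e e0; have e2 : 0 < e / 2 by lra.
have [h hh hgh] := hg _ e2; have [p hp] := hh _ e2; exists p => z Kz.
have := normc_triangle p.[z] (h z) (g z).
have := hp _ Kz; have := hgh _ Kz; lra.
Qed.

Lemma poly_limitD g h : poly_limit g -> poly_limit h ->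
  poly_limit (fun z => g z + h z).
Proof.
move=> hg hh e e0; have e2 : 0 < e / 2 by lra.
have [p hp] := hg _ e2; have [q hq] := hh _ e2; exists (p + q) => z Kz.
rewrite hornerD opprD addrACA; apply: le_trans (normcD_le _ _) _.
have := hp _ Kz; have := hq _ Kz; lra.
Qed.

Lemma poly_limitM g h : poly_limit g -> poly_limit h ->
  poly_limit (fun z => g z * h z).
Proof.
move=> hg hh e e0.
have [B B0 hB] := poly_limit_bounded hg.
have e1 : 0 < e / 2 / B by rewrite !divr_gt0.
have [q hq] := hh _ e1.
have W0 := wiener_ge0 q (@ler01 R).
have W1 : 0 < wiener 1 q + 1 by lra.
have e2 : 0 < e / 2 / (wiener 1 q + 1) by rewrite !divr_gt0.
have [p hp] := hg _ e2; exists (p * q) => z Kz.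
have -> : (p * q).[z] - g z * h z = (p.[z] - g z) * q.[z] + g z * (q.[z] - h z).
  by rewrite hornerM; ring.
apply: le_trans (normcD_le _ _) _; rewrite !normcM.
have z1 : normc z = 1 by exact: K_circle.
have hqz : normc q.[z] <= wiener 1 q + 1.
  by have := normc_horner q z; rewrite z1; lra.
have := ler_pM (normc_ge0 _) (normc_ge0 _) (hp _ Kz) hqz.
rewrite divfK ?gt_eqF // => h1.
have := ler_pM (normc_ge0 _) (normc_ge0 _) (hB _ Kz) (hq _ Kz).
rewrite [leRHS]mulrC divfK ?gt_eqF // => h2; lra.
Qed.

Lemma poly_limitX g n : poly_limit g -> poly_limit (fun z => g z ^+ n).
Proof.
move=> hg; elim: n => [|n IH]; first exact: (@poly_limit_cst 1).
apply: (@eq_poly_limit (fun z => g z * g z ^+ n)); last exact: poly_limitM.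
by move=> z _; rewrite exprS.
Qed.

Lemma poly_limit_sum (I : Type) (s : seq I) (F : I -> R[i] -> R[i]) :
  (forall i, poly_limit (F i)) -> poly_limit (fun z => \sum_(i <- s) F i z).
Proof.
move=> hF; elim: s => [|i s IH].
  by apply: (@eq_poly_limit (fun=> 0)) (poly_limit_cst 0) => z _; rewrite big_nil.
apply: (@eq_poly_limit (fun z => F i z + \sum_(i <- s) F i z)).
  by move=> z _; rewrite big_cons.
exact: poly_limitD.
Qed.

(** The inverse of [g] is the sum of the geometric series [t (1 - t g)^k]. *)
Lemma poly_limitV g (t q : R) : 0 < t -> 0 <= q < 1 ->
  (forall z, K z -> normc (1 - t%:C * g z) <= q) -> poly_limit g ->
  poly_limit (fun z => (g z)^-1).
Proof.
move=> t0 /andP[q0 q1] hq hg; apply: poly_limit_lim => e e0.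
have e1 : 0 < e * (1 - q) / t by rewrite divr_gt0 // mulr_gt0 //; lra.
have hq01 : 0 <= q < 1 by rewrite q0.
have [n hn] := expr_small hq01 e1.
pose y z := 1 - t%:C * g z.
exists (fun z => t%:C * \sum_(i <- iota 0 n) y z ^+ i).
  apply: poly_limitM; first exact: poly_limit_cst.
  apply: poly_limit_sum => i; apply: poly_limitX; apply: poly_limitD.
    exact: poly_limit_cst.
  apply: (@eq_poly_limit (fun z => (- t%:C) * g z)).
    by move=> z _; rewrite mulNr.
  by apply: poly_limitM => //; exact: poly_limit_cst.
move=> z Kz; have hy := hq _ Kz; rewrite -/(y z) in hy.
have tg : t%:C * g z = 1 - y z by rewrite /y; ring.
have hg1 : 1 - q <= t * normc (g z).
  have := normcB_ge 1 (y z); rewrite normc1 -tg normcM normc_real gtr0_norm //.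
  by lra.
have g0 : g z != 0.
  by rewrite -normc_gt0 -(pmulr_rgt0 _ t0); lra.
have -> : t%:C * (\sum_(i <- iota 0 n) y z ^+ i) - (g z)^-1 = - (y z ^+ n / g z).
  apply: (mulfI g0); rewrite mulrBr mulfV // mulrA [g z * _]mulrC tg.
  have -> : \sum_(i <- iota 0 n) y z ^+ i = \sum_(i < n) y z ^+ i.
    by rewrite -(big_mkord xpredT (fun i => y z ^+ i)) /index_iota subn0.
  rewrite -(opprB (y z)) mulNr -subrX1 mulrN mulrCA mulfV // mulr1.
  by rewrite opprB addrAC subrr add0r.
rewrite normc_opp normcM normcV normcX.
have gz0 : 0 < normc (g z) by rewrite normc_gt0.
rewrite ler_pdivrMr //.
have yn : normc (y z) ^+ n <= q ^+ n by rewrite lerXn2r ?nnegrE ?normc_ge0.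
apply: le_trans yn (le_trans (hn _ (leqnn n)) _).
rewrite ler_pdivrMr // -mulrA ler_wpM2l ?(ltW e0) // [normc _ * _]mulrC //.
Qed.

End Density.

Section CircleDensity.
Variable R : realType.
Implicit Types (z w x : R[i]) (K : set R[i]) (e d : R).

Lemma poly_limit_inv zeta d : normc zeta = 1 -> 0 < d ->
  poly_limit (arc zeta d) (fun z => z^-1).
Proof.
move=> zeta1 d0 e e0.
have h0 : 0 <= (0 : R) < 1 by rewrite lexx ltr01.
have [L [hL _]] := approx_one_on_arc 1 zeta1 d0 h0 e0.
exists L => z Ez; have := hL _ Ez.
have z1 : normc z = 1 by case: Ez.
have z0 : z != 0 by rewrite -normc_gt0 z1.
have -> : (L * 'X^1).[z] - 1 = (L.[z] - z^-1) * z.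
  by rewrite !hornerE mulrBl mulVf.
by rewrite normcM z1 mulr1.
Qed.

(** A kernel on the circle peaking at [w]: it is the real number
    [1 - |z - w|^2 / 4], here as a Laurent polynomial in [z]. *)
Definition peak w z : R[i] := (2 + w^-1 * z + w * z^-1) / 4.

Lemma conj_unit z : normc z = 1 -> z^-1 = z^*%C.
Proof.
move=> z1; have z0 : z != 0 by rewrite -normc_gt0 z1.
apply: (mulfI z0); rewrite mulfV // -sqr_normc.
by change (1 = (normc z)%:C ^+ 2 :> R[i]); rewrite z1 expr1n.
Qed.

Lemma peakE w z : normc w = 1 -> normc z = 1 ->
  peak w z = (1 - normc (z - w) ^+ 2 / 4)%:C.
Proof.
move=> w1 z1; have w0 : w != 0 by rewrite -normc_gt0 w1.
have z0 : z != 0 by rewrite -normc_gt0 z1.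
have h : (normc (z - w) ^+ 2)%:C = (z - w) * (z^-1 - w^-1).
  by rewrite (conj_unit w1) (conj_unit z1) -rmorphB -sqr_normc rmorphXn.
rewrite rmorphB fmorph_div /= h rmorph_nat rmorph1 /peak.
by field; apply/andP.
Qed.

Lemma poly_limit_peak zeta d w : normc zeta = 1 -> 0 < d ->
  poly_limit (arc zeta d) (peak w).
Proof.
move=> zeta1 d0; have circ : arc zeta d `<=` unit_circle by move=> z [].
apply: poly_limitM => //; last exact: poly_limit_cst.
apply: poly_limitD; first apply: poly_limitD.
- exact: poly_limit_cst.
- apply: (@eq_poly_limit _ _ (horner (w^-1 *: 'X))).
    by move=> z _; rewrite !hornerE.
  exact: poly_limit_horner.
- by apply: poly_limitM => //; [exact: poly_limit_cst|exact: poly_limit_inv].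
Qed.

Lemma poly_limit_sub K A g : K `<=` A -> poly_limit A g -> poly_limit K g.
Proof. by move=> KA hg e /hg[p hp]; exists p => z /KA; exact: hp. Qed.

(** The approximants are the quotients
    [\sum_w peak_w^n phi(w) / \sum_w peak_w^n], with [w] in a fine net. *)
Lemma poly_dense K zeta d (phi : R[i] -> R[i]) : normc zeta = 1 -> 0 < d ->
  K `<=` arc zeta d -> compact K -> {within K, continuous phi} ->
  poly_limit K phi.
Proof.
move=> zeta1 d0 Karc cK cphi; have circ : K `<=` unit_circle by move=> z /Karc[].
apply: poly_limit_lim => e e0; have e2 : 0 < e / 2 by lra.
have [delta0 delta00 hdelta0] := compact_unif_continuous cK cphi e2.
pose delta := Num.min delta0 1.
have delta_gt0 : 0 < delta by rewrite lt_min delta00 ltr01.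
have [dd0 dd1] : delta <= delta0 /\ delta <= 1.
  by rewrite /delta; split; rewrite ge_min lexx ?orbT.
have deltaP z w : K z -> K w -> normc (z - w) < delta ->
    normc (phi z - phi w) <= e / 2.
  by move=> Kz Kw h; apply: hdelta0 => //; exact: lt_le_trans dd0.
have d20 : 0 < delta / 2 by lra.
have [s [sK hs]] := compact_net cK d20.
pose B := \sum_(w <- s) normc (phi w) + e / 2.
have hB z : K z -> normc (phi z) <= B.
  move=> Kz; have [w ws hw] := hs _ Kz.
  have h1 : normc (phi z - phi w) <= e / 2.
    by apply: deltaP => //; [exact: sK|lra].
  have h2 : normc (phi w) <= \sum_(w <- s) normc (phi w).
    rewrite (big_rem w) //= lerDl; apply: sumr_ge0 => i _; exact: normc_ge0.
  have := normcB_ge (phi z) (phi w); rewrite /B; lra.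
have B0 : 0 <= B.
  rewrite addr_ge0 // ?(ltW e2) //; apply: sumr_ge0 => i _; exact: normc_ge0.
(* the kernel is at most a at distance delta or more from its peak, and
   greater than b at distance less than delta / 2 *)
pose a := 1 - delta ^+ 2 / 4; pose b := 1 - (delta / 2) ^+ 2 / 4.
have [a0 ab b0] : [/\ 0 <= a, a < b & 0 < b] by rewrite /a /b; split; nra.
pose S : R := (size s)%:R.
have S0 : 0 <= S by rewrite ler0n.
have q01 : 0 <= a / b < 1 by rewrite divr_ge0 ?(ltW b0) //= ltr_pdivrMr // mul1r.
have e3 : 0 < e / 2 / (2 * B * S + 1).
  have : 0 <= B * S by rewrite mulr_ge0.
  by move=> BS; rewrite divr_gt0 //; lra.
have [n hn] := expr_small q01 e3; move/(_ n (leqnn n)): hn => hn.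
pose k w z : R := 1 - normc (z - w) ^+ 2 / 4.
have k0 w z : K w -> K z -> 0 <= k w z.
  move=> /circ w1 /circ z1; have := normcB_le z w; rewrite w1 z1 /k.
  by have := normc_ge0 (z - w); nra.
have k1 w z : k w z <= 1 by rewrite /k; have := sqr_ge0 (normc (z - w)); lra.
have pE w z : K w -> K z -> peak w z ^+ n = (k w z ^+ n)%:C.
  by move=> /circ w1 /circ z1; rewrite peakE // rmorphXn.
pose D z := \sum_(w <- s) peak w z ^+ n.
pose Dr z := \sum_(w <- s) k w z ^+ n.
pose W z := \sum_(w <- s) peak w z ^+ n * phi w.
have DE z : K z -> D z = (Dr z)%:C.
  move=> Kz; rewrite /D /Dr rmorph_sum /=; apply: eq_big_seq => w ws.
  by rewrite pE //; exact: sK.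
have Drb z : K z -> b ^+ n <= Dr z.
  move=> Kz; have [w ws hw] := hs _ Kz; rewrite /Dr (big_rem w) //=.
  rewrite -[leLHS]addr0 lerD //.
    rewrite lerXn2r ?nnegrE ?(ltW b0) //; first by apply: k0 => //; exact: sK.
    by rewrite /k /b; have := normc_ge0 (z - w); nra.
  rewrite big_seq; apply: sumr_ge0 => i /mem_rem si; rewrite exprn_ge0 //.
  by apply: k0 => //; exact: sK.
have DrS z : K z -> Dr z <= S.
  move=> Kz; rewrite /Dr /S -sum1_size natr_sum big_seq [leRHS]big_seq.
  apply: ler_sum => w ws; rewrite exprn_ile1 ?k1 ?k0 //; exact: sK.
have bn0 : 0 < b ^+ n by rewrite exprn_gt0.
have peakK w : poly_limit K (peak w).
  by apply: poly_limit_sub Karc _; exact: poly_limit_peak.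
exists (fun z => W z * (D z)^-1).
  apply: poly_limitM => //.
    apply: poly_limit_sum => w; apply: poly_limitM => //.
      exact: poly_limitX.
    exact: poly_limit_cst.
  have t0 : 0 < (S + 1)^-1 by rewrite invr_gt0; lra.
  apply: (@poly_limitV _ _ circ D (S + 1)^-1 (Num.max 0 (1 - (S + 1)^-1 * b ^+ n))) => //.
  - rewrite le_max lexx /= gt_max ltr01 /=.
    by have := mulr_gt0 t0 bn0; lra.
  - move=> z Kz; rewrite DE // -rmorphM -(rmorph1 (real_complex R)) -rmorphB.
    rewrite normc_real.
    have h1 := ler_wpM2l (ltW t0) (Drb _ Kz).
    have h2 := ler_wpM2l (ltW t0) (DrS _ Kz).
    have h3 : (S + 1)^-1 * S <= 1 by rewrite mulrC ler_pdivrMr; lra.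
    by rewrite ger0_norm ?le_max; [apply/orP; right; lra|lra].
  - by apply: poly_limit_sum => w; exact: poly_limitX.
move=> z Kz.
have Dz0 : 0 < Dr z by apply: lt_le_trans bn0 (Drb _ Kz).
have D0 : D z != 0 by rewrite -normc_gt0 DE // normc_real gtr0_norm.
have -> : W z / D z - phi z = (\sum_(w <- s) peak w z ^+ n * (phi w - phi z)) / D z.
  apply: (mulIf D0); rewrite mulrBl !divfK // /W /D mulr_sumr -sumrB.
  by apply: eq_bigr => w _; rewrite mulrBr [phi z * _]mulrC.
rewrite normcM normcV DE // normc_real gtr0_norm //.
rewrite ler_pdivrMr //.
apply: (@le_trans _ _ (\sum_(w <- s) (e / 2 * k w z ^+ n + 2 * B * a ^+ n))).
  apply: le_trans (normc_sum _ _ _) _.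
  rewrite big_seq [leRHS]big_seq; apply: ler_sum => w ws.
  have Kw := sK _ ws; have kz := k0 _ _ Kw Kz.
  rewrite normcM pE // normc_real ger0_norm ?exprn_ge0 //.
  have an0 : 0 <= 2 * B * a ^+ n by rewrite !mulr_ge0 ?exprn_ge0.
  case: (ltP (normc (w - z)) delta) => hw.
    have := ler_wpM2l (exprn_ge0 n kz) (deltaP _ _ Kw Kz hw).
    by rewrite [_ * (e / 2)]mulrC; lra.
  have h1 : normc (phi w - phi z) <= 2 * B.
    by have := normcB_le (phi w) (phi z); have := hB _ Kw; have := hB _ Kz; lra.
  have h2 : k w z ^+ n <= a ^+ n.
    rewrite lerXn2r ?nnegrE // /k /a normc_distC.
    by nra.
  have := ler_pM (exprn_ge0 n kz) (normc_ge0 _) h2 h1.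
  have : 0 <= e / 2 * k w z ^+ n by rewrite mulr_ge0 ?exprn_ge0 // ltW.
  by rewrite [a ^+ n * _]mulrC; lra.
rewrite big_split /= -mulr_sumr -/(Dr z) big_const_seq count_predT iter_addr_0.
rewrite -[_ *+ size s]mulr_natr -/S.
have h1 : 2 * B * a ^+ n * S <= e / 2 * b ^+ n.
  move: hn; rewrite expr_div_n ler_pdivrMr // => hn.
  have BS : 0 <= B * S by rewrite mulr_ge0.
  have BS1 : 0 < 2 * B * S + 1 by lra.
  have := ler_wpM2l (ltW BS1) hn.
  rewrite mulrA mulrCA divff ?gt_eqF // mulr1.
  by have := exprn_ge0 n a0; lra.
have := ler_wpM2l (ltW e2) (Drb _ Kz); lra.
Qed.

End CircleDensity.

(** * Construction of a universal series *)

Section Construction.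
Variable R : realType.
Implicit Types (z w zeta : R[i]) (p : {poly R[i]}) (a : R[i] ^nat) (e d r : R).

(** Absolute convergence of [\sum a_k z^k] in the open unit disc. *)
Definition abs_conv a : Prop := forall r, 0 <= r < 1 ->
  exists B : R, forall n, \sum_(k < n) normc (a k) * r ^+ k <= B.

(** Universality with respect to the arcs and the polynomials only. *)
Definition universal_on_arcs a : Prop := forall zeta d p e N,
  normc zeta = 1 -> 0 < d -> 0 < e -> exists2 n : nat, (N <= n)%N &
    forall z, arc zeta d z -> normc (partial_sum a n z - p.[z]) <= e.

(** The countable families of centres and of polynomials used as targets. *)
Definition rat_point (q : rat * rat) : R[i] := ratr q.1 +i* ratr q.2.

Definition rat_poly (s : seq (rat * rat)) : {poly R[i]} :=
  foldr (fun c p => p * 'X + (rat_point c)%:P) 0 s.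

Lemma rat_point_dense z e : 0 < e -> exists q, normc (z - rat_point q) < e.
Proof.
move=> e0; have e2 : 0 < e / 2 by lra.
have approx (x : R) : exists q : rat, `|x - ratr q| < e / 2.
  have xe : x - e / 2 < x + e / 2 by lra.
  have [q] := rat_in_itvoo xe; rewrite in_itv /= => /andP[q1 q2]; exists q.
  by rewrite ltr_norml; apply/andP; split; lra.
have [q1 h1] := approx (complex.Re z); have [q2 h2] := approx (complex.Im z).
exists (q1, q2); apply: le_lt_trans (normc_le_ReIm _) _.
by case: z h1 h2 => x y /= h1 h2; lra.
Qed.

Lemma rat_poly_dense p e : 0 < e -> exists s, wiener 1 (p - rat_poly s) <= e.
Proof.
elim/poly_ind: p e => [|p c IH] e e0.
  by exists [::]; rewrite /= subrr wiener0 ltW.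
have e2 : 0 < e / 2 by lra.
have [s hs] := IH _ e2; have [q hq] := rat_point_dense c e2; exists (q :: s).
have -> : p * 'X + c%:P - rat_poly (q :: s) =
    (p - rat_poly s) * 'X + (c - rat_point q)%:P by rewrite /= polyCB; ring.
by rewrite wienerMXaddC mulr1; lra.
Qed.

(** A target [(c, m, s, j)]: the disc of centre [rat_point c] and radius
    [1/(m+1)] is removed, and [rat_poly s] is approximated up to [1/(j+1)]. *)
Definition target : Type := (rat * rat) * nat * seq (rat * rat) * nat.

(** [p] approximates the polynomial of the target on the part of the circle
    left by the removed disc, provided that this disc does meet the circle. *)
Definition meets_target (t : target) p : Prop :=
  let: (c, m, s, j) := t in
  (exists2 zeta, normc zeta = 1 & normc (zeta - rat_point c) < m.+1%:R^-1) ->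
  forall z, normc z = 1 -> m.+1%:R^-1 <= normc (z - rat_point c) ->
  normc (p.[z] - (rat_poly s).[z]) <= j.+1%:R^-1.

Lemma correction_exists p M i (t : target) : exists L,
  wiener (1 - i.+2%:R^-1) (L * 'X^M) <= (1 / 2) ^+ i /\
  meets_target t (p + L * 'X^M).
Proof.
have h0 : 0 <= (1 / 2 : R) ^+ i by rewrite exprn_ge0 // divr_ge0.
case: t => [[[c m] s] j]; rewrite /meets_target.
case: (pselect (exists2 zeta, normc zeta = 1 &
    normc (zeta - rat_point c) < m.+1%:R^-1)) => [[zeta zeta1 hzeta]|no]; last first.
  by exists 0; rewrite mul0r wiener0; split.
pose r : R := 1 - i.+2%:R^-1.
have r01 : 0 <= r < 1.
  have i0 : 0 < (i.+2%:R : R)^-1 by rewrite invr_gt0 ltr0n.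
  have i1 : (i.+2%:R : R)^-1 <= 1 by rewrite invf_le1 ?ltr0n // ler1n.
  by rewrite /r; move: i0 i1; set x := _^-1 => i0 i1; apply/andP; split; lra.
pose e : R := Num.min ((1 / 2) ^+ i) (j.+1%:R^-1).
have e0 : 0 < e by rewrite lt_min invr_gt0 ltr0n andbT exprn_gt0 // divr_gt0.
pose T := rat_poly s - p.
have T0 : 0 <= wiener 1 T by exact: wiener_ge0.
have T1 : 0 < wiener 1 T + 1 by lra.
have e1 : 0 < e / (wiener 1 T + 1) by rewrite divr_gt0.
have d0 : 0 < m.+1%:R^-1 - normc (zeta - rat_point c) by rewrite subr_gt0.
have [L [L1 L2]] := approx_one_on_arc M zeta1 d0 r01 e1.
have Te : wiener 1 T * (e / (wiener 1 T + 1)) <= e.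
  rewrite mulrA ler_pdivrMr // mulrDr mulr1 mulrC lerDl; exact: ltW.
exists (T * L); rewrite -mulrA; split.
  have r0 : 0 <= r by case/andP: r01.
  apply: le_trans (wienerM _ _ r0) _.
  apply: le_trans (ler_pM (wiener_ge0 _ r0) (wiener_ge0 _ r0) _ L2) (le_trans Te _).
    by apply: le_wiener; case/andP: r01 => -> /ltW.
  by rewrite ge_min lexx.
move=> _ z z1 hz.
have Ez : arc zeta (m.+1%:R^-1 - normc (zeta - rat_point c)) z.
  split=> //; rewrite lerBlDr; exact: le_trans hz (normc_triangle _ _ _).
have -> : (p + T * (L * 'X^M)).[z] - (rat_poly s).[z] = T.[z] * ((L * 'X^M).[z] - 1).
  by rewrite hornerD (hornerM T) /T hornerD hornerN; ring.
rewrite normcM; have := normc_horner T z; rewrite z1 => hT.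
apply: le_trans (ler_pM (normc_ge0 _) (normc_ge0 _) hT (L1 _ Ez)) (le_trans Te _).
by rewrite ge_min lexx orbT.
Qed.

Lemma injective_unbounded (f : nat -> nat) N J : injective f ->
  exists2 j, (J <= j)%N & (N <= f j)%N.
Proof.
move=> finj; apply: contrapT => h.
have hlt j : (J <= j)%N -> (f j < N)%N.
  by move=> Jj; rewrite ltnNge; apply/negP => Nf; apply: h; exists j.
have : (size [seq f j | j <- iota J N.+1] <= size (iota 0 N))%N.
  apply: uniq_leq_size; first by rewrite map_inj_uniq // iota_uniq.
  move=> k /mapP[j]; rewrite mem_iota => /andP[Jj _] ->.
  by rewrite mem_iota /= add0n hlt.
by rewrite size_map !size_iota ltnn.
Qed.

Lemma inv_nat_small e : 0 < e -> exists J : nat, forall j, (J <= j)%N ->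
  (j.+1%:R : R)^-1 < e.
Proof.
move=> e0; exists (Num.bound e^-1) => j Jj.
rewrite invf_plt ?posrE ?ltr0n //.
apply: lt_le_trans (archi_boundP _) _; first by rewrite invr_ge0 ltW.
by rewrite ler_nat leqW.
Qed.

(** The series is a sum of polynomial blocks with disjoint spectra; the block
    number [i] makes the partial sum meet the target number [i] and has
    Wiener norm at most [2^-i] on the disc of radius [1 - 1/(i+2)]. *)
Lemma universal_on_arcs_exists : exists a, abs_conv a /\ universal_on_arcs a.
Proof.
pose good (x : {poly R[i]} * nat * nat) (L : {poly R[i]}) :=
  wiener (1 - x.2.+2%:R^-1) (L * 'X^(x.1.2)) <= (1 / 2) ^+ x.2 /\
  forall t : target, unpickle x.2 = Some t ->
    meets_target t (x.1.1 + L * 'X^(x.1.2)).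
have /choice[F hF] : forall x, exists L, good x L.
  move=> [[p M] i]; rewrite /good /=.
  case: (unpickle i) => [t|].
    by have [L [L1 L2]] := correction_exists p M i t; exists L; split=> // _ [<-].
  by exists 0; rewrite mul0r wiener0; split=> //; rewrite exprn_ge0 ?divr_ge0.
(* the pair (S i, M i): sum of the first blocks, first free exponent *)
pose st := fix st (i : nat) : {poly R[i]} * nat := if i is i'.+1 then
  let x := st i' in let p := x.1 + F (x, i') * 'X^(x.2) in
  (p, maxn (size p) x.2.+1) else (0, 0%N).
pose S i := (st i).1; pose M i := (st i).2.
pose P i := F (st i, i) * 'X^(M i).
have SS i : S i.+1 = S i + P i by [].
have MS i : M i.+1 = maxn (size (S i.+1)) (M i).+1 by [].
have sizeS i : (size (S i) <= M i)%N.
  by case: i => [|i]; [rewrite size_poly0|rewrite MS leq_maxl].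
have Mmono i j : (i <= j)%N -> (M i <= M j)%N.
  move=> /subnK <-; elim: (j - i)%N => [|t IH] //.
  by rewrite addSn MS (leq_trans IH) // leq_max leqnSn orbT.
have Mge i : (i <= M i)%N.
  by elim: i => [//|i IH]; rewrite MS leq_max ltnS IH orbT.
have stab i j k : (k < M i)%N -> (i <= j)%N -> (S j)`_k = (S i)`_k.
  move=> kM /subnK <-; elim: (j - i)%N => [|t IH] //.
  rewrite addSn SS coefD IH /P coefMXn ifT ?addr0 //.
  by rewrite (leq_trans kM) // Mmono // leq_addl.
pose a : R[i] ^nat := fun k => (S k.+1)`_k.
have aE i k : (k < M i)%N -> a k = (S i)`_k.
  move=> kM; rewrite /a; case: (leqP i k.+1) => h; first exact: stab.
  by rewrite (stab k.+1 i) // ?Mge // ltnW.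
exists a; split.
  move=> r /andP[r0 r1].
  have r1' : 0 < 1 - r by lra.
  have [i0 hi0] := inv_nat_small r1'.
  exists (wiener r (S i0) + 2) => n.
  have step t : wiener r (S (t + i0)%N) <= wiener r (S i0) + (2 - 2 * (1 / 2) ^+ t).
    elim: t => [|t IH]; first by rewrite expr0; lra.
    rewrite addSn SS; apply: le_trans (wiener_add _ _ r0) _.
    have h1 : wiener r (P (t + i0)%N) <= (1 / 2) ^+ (t + i0)%N.
      have [h _] := hF (st (t + i0)%N, (t + i0)%N); apply: le_trans h.
      apply: le_wiener; rewrite r0 /=.
      rewrite /= lerBrDr addrC -lerBrDr ltW // hi0 //.
      by rewrite (leq_trans (leq_addl t i0)).
    have h2 : (1 / 2 : R) ^+ (t + i0)%N <= (1 / 2) ^+ t.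
      by rewrite exprD ler_piMr ?exprn_ge0 ?exprn_ile1 //; lra.
    by rewrite exprS; lra.
  apply: (@le_trans _ _ (wiener r (S (n + i0)%N))); last first.
    apply: le_trans (step n) _.
    have : 0 <= (1 / 2 : R) ^+ n by rewrite exprn_ge0 // divr_ge0.
    lra.
  rewrite (wiener_widen r (sizeS _)).
  have nM : (n <= M (n + i0)%N)%N.
    by apply: leq_trans (Mge n) (Mmono _ _ _); exact: leq_addr.
  rewrite (big_ord_widen _ (fun k => normc (a k) * r ^+ k) nM).
  rewrite [leRHS](bigID (fun k : 'I_(M (n + i0)%N) => (k < n)%N)) /=.
  rewrite -[leLHS]addr0 lerD //.
    by apply: ler_sum => k kn; rewrite (aE (n + i0)%N).
  by apply: sumr_ge0 => k _; rewrite mulr_ge0 ?normc_ge0 ?exprn_ge0.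
move=> zeta d p e N zeta1 d0 e0.
have e2 : 0 < e / 2 by lra. have d2 : 0 < d / 2 by lra.
have [m hm] := inv_nat_small d2; move/(_ m (leqnn m)): hm => hm.
have m0 : 0 < (m.+1%:R : R)^-1 by rewrite invr_gt0 ltr0n.
have [c hc] := rat_point_dense zeta m0.
have [s hs] := rat_poly_dense p e2.
have [J hJ] := inv_nat_small e2.
have finj : injective (fun j : nat => pickle ((c, m, s, j) : target)).
  by move=> j j' /(pcan_inj pickleK) [].
have [j Jj Nj] := injective_unbounded N J finj.
have [i [iE Ni]] : exists i, unpickle i = Some ((c, m, s, j) : target) /\ (N <= i)%N.
  by exists (pickle ((c, m, s, j) : target)); rewrite pickleK.
exists (M i.+1).-1.
  by have := Mge i.+1; case: (M i.+1) => // k; rewrite ltnS; exact: leq_trans.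
move=> z [z1 hz].
have -> : partial_sum a (M i.+1).-1 z = (S i.+1).[z].
  have M0 : (0 < M i.+1)%N by exact: leq_trans (Mge i.+1).
  rewrite /partial_sum prednK // big_mkord (horner_coef_wide _ (sizeS _)).
  by apply: eq_bigr => k _; rewrite -(aE i.+1).
have ht : meets_target (c, m, s, j) (S i.+1) := (hF (st i, i)).2 _ iE.
have h1 : normc ((S i.+1).[z] - (rat_poly s).[z]) <= j.+1%:R^-1.
  apply: ht => //; first by exists zeta.
  have := normc_triangle z (rat_point c) zeta.
  rewrite (normc_distC (rat_point c)).
  by move: hm hc; set x := _^-1 => hm hc; lra.
have h2 : normc ((rat_poly s).[z] - p.[z]) <= e / 2.
  rewrite normc_distC -hornerN -hornerD; apply: le_trans (normc_horner _ _) _.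
  by rewrite z1.
apply: le_trans (normc_triangle _ (rat_poly s).[z] _) _.
by have := hJ j Jj; move: h1; set x := _^-1 => h1 h3; lra.
Qed.

End Construction.

(** * A lacunary perturbation keeping weighted partial sums away from 0 *)

Section Perturbation.
Variable R : realType.
Implicit Types (w : nat -> R[i]) (a c : R[i] ^nat) (u v : R[i]) (e : R).

(** Two distinct points of the grid [2 Z[i]] are at distance at least 2, so
    each [w n] rules out at most one of the [(2^(i+1) + 1)^2] points tried. *)
Lemma avoid_finite w i : exists2 u, normc u <= 8 * 2 ^+ i &
  forall n, (n < 4 ^ i.+1)%N -> 1 <= normc (w n + u).
Proof.
pose S := (2 ^ i.+1).+1.
pose u (x : 'I_S * 'I_S) : R[i] := (2 * x.1%:R) +i* (2 * x.2%:R).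
have uS x : normc (u x) <= 8 * 2 ^+ i.
  have h (k : 'I_S) : `|2 * k%:R : R| <= 4 * 2 ^+ i.
    rewrite ger0_norm ?mulr_ge0 ?ler0n //.
    have : (k%:R : R) <= (2 ^ i.+1)%:R by rewrite ler_nat -ltnS.
    by rewrite natrX exprS; lra.
  by have := normc_le_ReIm (u x); have := h x.1; have := h x.2; rewrite /u /=; lra.
apply: contrapT => no.
have bad x : {n : 'I_(4 ^ i.+1) | normc (w n + u x) < 1}.
  apply: cid; apply: contrapT => hx; apply: no; exists (u x) => // n ni.
  by rewrite leNgt; apply/negP => hn; apply: hx; exists (Ordinal ni).
pose f x := sval (bad x).
have finj : injective f.
  move=> x y fxy; have := svalP (bad y); have := svalP (bad x).
  rewrite -/(f x) -/(f y) -fxy => hx hy.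
  have h : normc (u x - u y) < 2.
    have -> : u x - u y = (w (f x) + u x) - (w (f x) + u y) by ring.
    by apply: le_lt_trans (normcB_le _ _) _; lra.
  have ord (j k : 'I_S) : `|2 * j%:R - 2 * k%:R : R| < 2 -> j = k.
    move=> hjk; apply/val_inj/eqP; rewrite eqn_leq.
    move: hjk; rewrite ltr_norml => /andP[h1 h2].
    by apply/andP; split; rewrite -ltnS -(ltr_nat R) -natr1; lra.
  have h1 := le_lt_trans (Re_le_normc _) h.
  have h2 := le_lt_trans (Im_le_normc _) h.
  case: x y h1 h2 {fxy hx hy h} => [x1 x2] [y1 y2] /= h1 h2.
  by rewrite (ord _ _ h1) (ord _ _ h2).
have := leq_card f finj; rewrite card_prod !card_ord.
rewrite (_ : (4 = 2 ^ 2)%N) // -expnM mulnC expnM expnS expn1 leqNgt.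
by rewrite /S ltn_mul.
Qed.

Lemma ffact_ge n l : (0 < l <= n)%N -> (n <= n ^_ l)%N.
Proof.
by case: l n => [//|l] [//|n]; rewrite ltnS ffactSS => ln; rewrite leq_pmulr ?ffact_gt0.
Qed.

Lemma trunc_log4_step k : trunc_log 4 k.+1 = trunc_log 4 k \/
  trunc_log 4 k.+1 = (trunc_log 4 k).+1 /\ k.+1 = (4 ^ (trunc_log 4 k).+1)%N.
Proof.
case: k => [|k]; first by left; rewrite trunc_log1 trunc_log0.
have /andP[h1 h2] := trunc_log_bounds (isT : (1 < 4)%N) (ltn0Sn k).
move: h2; rewrite leq_eqVlt => /orP[/eqP h2|h2].
  right; split=> //; apply: trunc_log_eq => //.
  by rewrite h2 leqnn ltn_exp2l // ltnSn.
by left; apply: trunc_log_eq => //; rewrite h2 (leq_trans h1).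
Qed.

(** The function [b] controls the tails of [\sum |c_k|]. *)
Lemma avoid_zero a l : (0 < l)%N -> exists c (b : nat -> R),
  [/\ c 0%N = 0, forall k, normc (c k.+1) <= b k - b k.+1,
      forall e, 0 < e -> exists N : nat, forall n, (N <= n)%N -> 0 <= b n <= e &
      exists N, forall n, (N <= n)%N ->
        1 <= normc (\sum_(k < n.+1) (k ^_ l)%:R * (a k + c k))].
Proof.
move=> l0; pose w n := \sum_(k < n.+1) (k ^_ l)%:R * a k.
have /choice[G hG] : forall x : nat * R[i], exists u, normc u <= 16 * 2 ^+ x.1 /\
    forall n, (n < 4 ^ x.1.+2)%N -> 1 <= normc (w n + x.2 + u).
  move=> [i v] /=; have [u u1 u2] := avoid_finite (fun n => w n + v) i.+1.
  by exists u; split=> //; rewrite exprS in u1; lra.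
(* V i is the sum of the translations made up to the exponent 4 ^ i; it is 0
   for i <= l since the weight k ^_ l may vanish for the small k *)
pose V := fix V i := if i is i'.+1 then
  (if (i' < l)%N then 0 else V i' + G (i', V i')) else 0 : R[i].
have V0 i : (i <= l)%N -> V i = 0 by case: i => //= i ->.
have VS i : normc (V i.+1 - V i) <= 16 * 2 ^+ i.
  have h0 : 0 <= 16 * 2 ^+ i :> R by rewrite mulr_ge0 // exprn_ge0.
  case: (ltnP i l) => il; first by rewrite !V0 ?subrr ?normc0 // ltnW.
  rewrite /= ltnNge il /= addrC addKr.
  by have [] := hG (i, V i).
pose W n := V (trunc_log 4 n).
have trunc_le n : (trunc_log 4 n <= n)%N.
  case: n => [|n]; first by rewrite trunc_log0.
  have /andP[h _] := trunc_log_bounds (isT : (1 < 4)%N) (ltn0Sn n).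
  by apply: leq_trans h; apply: ltnW; exact: ltn_expl.
(* the weighted partial sums of c telescope to W *)
pose c k := if k is k'.+1 then (W k - W k') / (k ^_ l)%:R else 0 : R[i].
pose b k : R := 8 * (1 / 2) ^+ (trunc_log 4 k).
have b_ge0 k : 0 <= b k by rewrite mulr_ge0 // exprn_ge0 // divr_ge0.
exists c, b; split=> //.
- move=> k; rewrite /c /W /b.
  case: (trunc_log4_step k) => [->|[-> hk]]; first by rewrite !subrr mul0r normc0.
  set t := trunc_log 4 k in hk *.
  have p0 : 0 < 2 ^+ t :> R by rewrite exprn_gt0.
  have -> : 8 * (1 / 2) ^+ t - 8 * (1 / 2) ^+ t.+1 = 4 / 2 ^+ t :> R.
    by rewrite exprS expr_div_n expr1n; field; rewrite gt_eqF.
  case: (ltnP t l) => tl.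
    by rewrite !V0 ?subrr ?mul0r ?normc0 ?divr_ge0 ?(ltW p0) // ltnW.
  have kl : (0 < l <= k.+1)%N.
    by rewrite l0 hk (leq_trans tl) // ltnW // ltnW // ltn_expl.
  have f0 : 0 < ((k.+1 ^_ l)%:R : R).
    by rewrite ltr0n; apply: leq_trans (ffact_ge kl).
  rewrite normcM normcV normc_nat ler_pdivrMr //.
  apply: le_trans (VS t) _.
  apply: (@le_trans _ _ (4 / 2 ^+ t * k.+1%:R)); last first.
    by rewrite ler_wpM2l ?divr_ge0 ?(ltW p0) // ler_nat ffact_ge.
  have -> : k.+1%:R = 4 * (2 ^+ t) ^+ 2 :> R.
    by rewrite hk natrX exprS -exprM mulnC exprM -[2 ^+ 2]natrX.
  suff -> : 4 / 2 ^+ t * (4 * (2 ^+ t) ^+ 2) = 16 * 2 ^+ t :> R by [].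
  by field; rewrite gt_eqF.
- move=> e e0; have e8 : 0 < e / 8 by lra.
  have h2 : 0 <= (1 / 2 : R) < 1 by lra.
  have [N hN] := expr_small h2 e8; exists (4 ^ N)%N => n Nn; rewrite b_ge0 /=.
  have n0 : (0 < n)%N by apply: leq_trans Nn; rewrite expn_gt0.
  have := hN (trunc_log 4 n); rewrite trunc_log_max // => /(_ isT).
  by rewrite /b; lra.
- exists (4 ^ l.+1)%N => n ln.
  have n0 : (0 < n)%N by apply: leq_trans ln; rewrite expn_gt0.
  have sumc m : \sum_(k < m.+1) (k ^_ l)%:R * c k = W m.
    elim: m => [|m IH].
      by rewrite big_ord_recl big_ord0 addr0 mulr0 /W trunc_log0.
    rewrite big_ord_recr /= IH; case: (ltnP m.+1 l) => ml.
      rewrite ffact_small // mul0r addr0 /W !V0 //.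
        by rewrite (leq_trans (trunc_le _)) // ltnW.
      by rewrite (leq_trans (trunc_le _)) // ltnW // ltnW.
    rewrite mulrC divfK ?subrKC //.
    by rewrite -normc_gt0 normc_nat ltr0n ffact_gt0.
  have -> : \sum_(k < n.+1) (k ^_ l)%:R * (a k + c k) = w n + W n.
    by rewrite -sumc -big_split; apply: eq_bigr => k _; rewrite mulrDr.
  have tl : (l < trunc_log 4 n)%N by rewrite trunc_log_max.
  have /andP[_ h2] := trunc_log_bounds (isT : (1 < 4)%N) n0.
  move: tl h2; rewrite /W; case: (trunc_log 4 n) => [//|t]; rewrite ltnS => lt nt.
  rewrite /= ltnNge lt /= addrA.
  by have [_] := hG (t, V t); apply.
Qed.

End Perturbation.

(** * Power series and their derivatives *)

Section PowerSeries.
Variable R : realType.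
Implicit Types (z h : R[i]) (a : R[i] ^nat) (f : R[i] -> R[i]) (e r rho : R).

Lemma cvg_normcP (u : R[i] ^nat) (l : R[i]) : u @ \oo --> l <->
  forall e, 0 < e -> exists N : nat, forall n, (N <= n)%N -> normc (l - u n) <= e.
Proof.
split=> [ul e e0|h A /nbhs_normcP[e e0 eA]].
  have : nbhs l [set w | normc (l - w) <= e].
    by apply/nbhs_normcP; exists e => // w /ltW.
  by move/ul => [N _ hN]; exists N => n; exact: hN.
have e2 : 0 < e / 2 by lra.
have [N hN] := h _ e2; exists N => // n /= /hN hn; apply: eA.
by apply: le_lt_trans hn _; lra.
Qed.

Lemma partial_sumE a n z : partial_sum a n z = \sum_(k < n.+1) a k * z ^+ k.
Proof. by rewrite /partial_sum big_mkord. Qed.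

Lemma real_series_cvg (u : R ^nat) (B : R) :
  (forall n, \sum_(k < n) `|u k| <= B) -> cvgn (series u).
Proof.
move=> hB; apply: normed_cvg; apply: nondecreasing_is_cvgn.
  by apply: nondecreasing_series => n _ _ /=.
exists B => _ [n _ <-]; apply: le_trans (hB n).
by rewrite -(big_mkord xpredT (fun k => `|u k|)).
Qed.

Lemma Re_sum (I : Type) (s : seq I) (F : I -> R[i]) :
  complex.Re (\sum_(i <- s) F i) = \sum_(i <- s) complex.Re (F i).
Proof.
elim: s => [|i s IH]; rewrite ?big_nil // !big_cons -IH.
by case: (F i); case: (\sum_(j <- s) F j).
Qed.

Lemma Im_sum (I : Type) (s : seq I) (F : I -> R[i]) :
  complex.Im (\sum_(i <- s) F i) = \sum_(i <- s) complex.Im (F i).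
Proof.
elim: s => [|i s IH]; rewrite ?big_nil // !big_cons -IH.
by case: (F i); case: (\sum_(j <- s) F j).
Qed.

Lemma abs_conv_cvg a z : abs_conv a -> normc z < 1 ->
  exists l : R[i], partial_sum a ^~ z @ \oo --> l.
Proof.
move=> ca z1; have hz : 0 <= normc z < 1 by rewrite normc_ge0.
have [B hB] := ca _ hz.
have bound (g : R[i] -> R) : (forall x, `|g x| <= normc x) ->
    forall n, \sum_(k < n) `|g (a k * z ^+ k)| <= B.
  move=> hg n; apply: le_trans (hB n); apply: ler_sum => k _.
  by rewrite -normcX -normcM.
have /cvg_ex[/= x hx] :=
  @real_series_cvg (fun k => complex.Re (a k * z ^+ k)) _ (bound _ (@Re_le_normc R)).
have /cvg_ex[/= y hy] :=
  @real_series_cvg (fun k => complex.Im (a k * z ^+ k)) _ (bound _ (@Im_le_normc R)).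
exists (x +i* y); apply/cvg_normcP => e e0.
have e2 : 0 < e / 2 by lra.
move/cvgrPdist_le: hx => /(_ _ e2)[N1 _ h1].
move/cvgrPdist_le: hy => /(_ _ e2)[N2 _ h2].
exists (maxn N1 N2) => n; rewrite geq_max => /andP[n1 n2].
apply: le_trans (normc_le_ReIm _) _.
have ReE : complex.Re (partial_sum a n z) =
    series (fun k => complex.Re (a k * z ^+ k)) n.+1 by exact: Re_sum.
have ImE : complex.Im (partial_sum a n z) =
    series (fun k => complex.Im (a k * z ^+ k)) n.+1 by exact: Im_sum.
have := h1 n.+1 (leqW n1); have := h2 n.+1 (leqW n2).
rewrite /= -/(series _ _) -/(series _ _) -ReE -ImE.
by case: (partial_sum a n z) => s t /=; lra.
Qed.

(** The coefficients of the derived series. *)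
Definition dseq a : R[i] ^nat := fun k => k.+1%:R * a k.+1.

Lemma iter_dseqE a m k : iter m dseq a k = ((k + m) ^_ m)%:R * a (k + m)%N.
Proof.
elim: m k => [|m IH] k; first by rewrite ffactn0 mul1r addn0.
by rewrite iterS /dseq IH mulrA -natrM addSnnS ffactnSr addnS subSn ?leq_addl // addnK mulnC.
Qed.

Lemma expr_derive_bound r rho k : 0 <= r <= rho ->
  k.+1%:R * r ^+ k * (rho - r) <= rho ^+ k.+1 - r ^+ k.+1.
Proof.
move=> /andP[r0 rrho]; elim: k => [|k IH]; first by rewrite !expr1 expr0 !mul1r.
have rho0 : 0 <= rho by exact: le_trans rrho.
have h : r ^+ k.+1 <= rho ^+ k.+1 by rewrite lerXn2r ?nnegrE.
have h1 := ler_wpM2l r0 IH.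
have h2 : 0 <= rho - r by lra.
have h3 := ler_wpM2r h2 h.
rewrite -[k.+2%:R]natr1 (exprS rho k.+1) (exprS r k.+1).
have -> : (k.+1%:R + 1) * r ^+ k.+1 * (rho - r) =
    r * (k.+1%:R * r ^+ k * (rho - r)) + r ^+ k.+1 * (rho - r).
  by rewrite exprS; ring.
by lra.
Qed.

Lemma abs_conv_dseq a : abs_conv a -> abs_conv (dseq a).
Proof.
move=> ca r /andP[r0 r1]; pose rho := (1 + r) / 2.
have [rrho rho1] : r < rho /\ rho < 1 by rewrite /rho; split; lra.
have rho0 : 0 <= rho < 1 by apply/andP; split; lra.
have [B hB] := ca _ rho0; exists (B / (rho - r)) => n.
have d0 : 0 < rho - r by lra.
rewrite ler_pdivlMr //; apply: le_trans (hB n.+1).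
rewrite big_ord_recl mulr_suml -[leLHS]add0r lerD //.
  by rewrite mulr_ge0 ?normc_ge0.
apply: ler_sum => k _ /=; rewrite /dseq normcM normc_nat.
have rr : 0 <= r <= rho by rewrite r0 ltW.
have h := expr_derive_bound k rr.
have h' : k.+1%:R * r ^+ k * (rho - r) <= rho ^+ k.+1.
  by have := exprn_ge0 k.+1 r0; lra.
by have := ler_wpM2l (normc_ge0 (a k.+1)) h'; rewrite /bump /= add1n; lra.
Qed.

Lemma expr_taylor_bound z h rho k : normc z <= rho -> normc (z + h) <= rho ->
  normc ((z + h) ^+ k.+2 - z ^+ k.+2 - k.+2%:R * h * z ^+ k.+1) <=
  normc h ^+ 2 * (k.+2%:R * k.+1%:R * rho ^+ k).
Proof.
move=> z1 z2; have rho0 : 0 <= rho by apply: le_trans z1; exact: normc_ge0.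
elim: k => [|k IH].
  have -> : (z + h) ^+ 2 - z ^+ 2 - 2%:R * h * z ^+ 1 = h ^+ 2 by ring.
  rewrite normcX expr0; have := sqr_ge0 (normc h); lra.
have -> : (z + h) ^+ k.+3 - z ^+ k.+3 - k.+3%:R * h * z ^+ k.+2 =
    (z + h) * ((z + h) ^+ k.+2 - z ^+ k.+2 - k.+2%:R * h * z ^+ k.+1) +
    k.+2%:R * h ^+ 2 * z ^+ k.+1.
  by rewrite -[k.+3%:R]natr1 !exprS; ring.
apply: le_trans (normcD_le _ _) _; rewrite !normcM !normcX normc_nat.
have h1 := ler_pM (normc_ge0 _) (normc_ge0 _) z2 IH.
have h2 : normc z ^+ k.+1 <= rho ^+ k.+1 by rewrite lerXn2r ?nnegrE ?normc_ge0.
have h0 : 0 <= k.+2%:R * normc h ^+ 2 by rewrite mulr_ge0 ?sqr_ge0.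
have h3 := ler_wpM2l h0 h2.
apply: le_trans (lerD h1 h3) _.
rewrite -[k.+3%:R]natr1 -[k.+2%:R in X in _ <= X]natr1 (exprS rho).
rewrite -[k.+2%:R]natr1.
have p1 : 0 <= normc h ^+ 2 * (rho * rho ^+ k).
  by rewrite mulr_ge0 ?sqr_ge0 // mulr_ge0 // exprn_ge0.
have p2 : 0 <= (k.+1%:R : R) by [].
have := mulr_ge0 p1 p2; lra.
Qed.

(** A Taylor remainder of order 2; the constant bounds the second derived
    series on the disc of radius [rho]. *)
Lemma power_series_taylor f a z (l : R[i]) rho : abs_conv a ->
  power_expansion f a -> normc z < rho -> rho < 1 ->
  partial_sum (dseq a) ^~ z @ \oo --> l ->
  exists2 B : R, 0 <= B & forall h, normc h <= rho - normc z ->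
    normc (f (z + h) - f z - h * l) <= normc h ^+ 2 * B.
Proof.
move=> ca fa zrho rho1 hl.
have hrho : 0 <= rho < 1 by rewrite rho1 andbT ltW // (le_lt_trans (normc_ge0 z)).
have [B hB] := abs_conv_dseq (abs_conv_dseq ca) hrho.
exists B; first by have := hB 0%N; rewrite big_ord0.
move=> h hh.
have z2 : normc (z + h) <= rho by have := normcD_le z h; lra.
have fz : partial_sum a ^~ z @ \oo --> f z by apply: fa; exact: lt_trans rho1.
have fzh : partial_sum a ^~ (z + h) @ \oo --> f (z + h).
  by apply: fa; exact: le_lt_trans rho1.
have finite n : normc (partial_sum a n.+1 (z + h) - partial_sum a n.+1 z -
    h * partial_sum (dseq a) n z) <= normc h ^+ 2 * B.
  have -> : partial_sum a n.+1 (z + h) - partial_sum a n.+1 z -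
      h * partial_sum (dseq a) n z = \sum_(k < n) a k.+2 *
        ((z + h) ^+ k.+2 - z ^+ k.+2 - k.+2%:R * h * z ^+ k.+1).
    have E w : partial_sum a n.+1 w = a 0%N + \sum_(k < n.+1) a k.+1 * w ^+ k.+1.
      by rewrite partial_sumE big_ord_recl expr0 mulr1.
    rewrite !E partial_sumE mulr_sumr opprD addrACA subrr add0r -!sumrB.
    rewrite big_ord_recl /= /dseq !expr1 expr0.
    rewrite [X in X + _](_ : _ = 0) ?add0r; last by ring.
    apply: eq_bigr => k _; rewrite /bump /= !add1n; ring.
  apply: le_trans (normc_sum _ _ _) _.
  apply: le_trans (ler_wpM2l (sqr_ge0 _) (hB n)); rewrite mulr_sumr.
  apply: ler_sum => k _; rewrite normcM /dseq !normcM !normc_nat.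
  have := ler_wpM2l (normc_ge0 (a k.+2)) (expr_taylor_bound k (ltW zrho) z2).
  by lra.
apply/ler_addgt0Pr => e e0.
pose e' := e / (2 + normc h).
have h20 : 0 < 2 + normc h by have := normc_ge0 h; lra.
have e'0 : 0 < e' by rewrite divr_gt0.
move/cvg_normcP: fz => /(_ _ e'0)[N1 h1].
move/cvg_normcP: fzh => /(_ _ e'0)[N2 h2].
move/cvg_normcP: hl => /(_ _ e'0)[N3 h3].
pose n := (N1 + N2 + N3)%N.
have n1 : (N1 <= n.+1)%N by apply: leqW; rewrite /n -addnA leq_addr.
have n2 : (N2 <= n.+1)%N by apply: leqW; rewrite /n addnAC leq_addl.
have n3 : (N3 <= n)%N by rewrite /n leq_addl.
have -> : f (z + h) - f z - h * l =
   (partial_sum a n.+1 (z + h) - partial_sum a n.+1 z -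
    h * partial_sum (dseq a) n z) +
   ((f (z + h) - partial_sum a n.+1 (z + h)) - (f z - partial_sum a n.+1 z) -
    h * (l - partial_sum (dseq a) n z)) by ring.
apply: le_trans (normcD_le _ _) _; apply: lerD; first exact: finite.
apply: le_trans (normcB_le _ _) _; rewrite normcM.
have := normcB_le (f (z + h) - partial_sum a n.+1 (z + h)) (f z - partial_sum a n.+1 z).
have := h1 _ n1; have := h2 _ n2.
have := ler_wpM2l (normc_ge0 h) (h3 _ n3).
have : e' * (2 + normc h) = e by rewrite divfK // gt_eqF.
lra.
Qed.

Lemma power_series_derive f a z : abs_conv a -> power_expansion f a ->
  unit_disc z -> derivable f z 1 /\
  partial_sum (dseq a) ^~ z @ \oo --> (f^`())%classic z.
Proof.
move=> ca fa z1; have [l hl] := abs_conv_cvg (abs_conv_dseq ca) z1.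
pose rho := (1 + normc z) / 2.
have z1' : normc z < 1 by [].
have [zrho rho1] : normc z < rho /\ rho < 1 by rewrite /rho; split; lra.
have [B B0 hB] := power_series_taylor ca fa zrho rho1 hl.
have cvgl : (fun h : R[i] => h^-1 *: (f (h + z) - f z)) @ 0^' --> l.
  move=> A /nbhs_normcP[e e0 eA].
  pose d := Num.min (rho - normc z) (e / (B + 1)).
  have BB : 0 < B + 1 by lra.
  have d0 : 0 < d by rewrite lt_min divr_gt0 // andbT; lra.
  have [d1 d2] : d <= rho - normc z /\ d <= e / (B + 1).
    by rewrite /d; split; rewrite ge_min lexx ?orbT.
  apply/nbhs_normcP; exists d => // h; rewrite sub0r normc_opp => hd h0.
  apply: eA.
  have hn : 0 < normc h by rewrite normc_gt0.
  have -> : l - h^-1 *: (f (h + z) - f z) = - (h^-1 * (f (z + h) - f z - h * l)).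
    change (l - h^-1 * (f (h + z) - f z) = - (h^-1 * (f (z + h) - f z - h * l))).
    by rewrite [h + z]addrC; field; exact: h0.
  rewrite normc_opp normcM normcV mulrC ltr_pdivrMr //.
  have hB' := hB h (le_trans (ltW hd) d1).
  apply: le_lt_trans hB' _; rewrite expr2 -mulrA [e * _]mulrC.
  rewrite ltr_pM2l //.
  have h1 : normc h * (B + 1) < e by rewrite -ltr_pdivlMr //; exact: lt_le_trans d2.
  by lra.
split.
  rewrite /derivable; apply/cvg_ex; exists l.
  suff -> : (fun h : R[i] => h^-1 *: ((f \o shift z) (h *: (1 : R[i])) - f z)) =
      (fun h : R[i] => h^-1 *: (f (h + z) - f z)) by [].
  by apply/funext => h /=; congr (_ *: (f (_ + _) - _)); exact: mulr1.
suff -> : (f^`())%classic z = l by [].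
by apply: cvg_lim => //; exact: norm_hausdorff.
Qed.

Lemma power_series_derive1n f a m : abs_conv a -> power_expansion f a ->
  abs_conv (iter m dseq a) /\ power_expansion (f^`(m))%classic (iter m dseq a).
Proof.
move=> ca fa; elim: m => [//|m [c e]].
rewrite derive1nS iterS; split; first exact: abs_conv_dseq.
by move=> z z1; have [] := power_series_derive c e z1.
Qed.

Lemma power_series_at0 f a : power_expansion f a -> f 0 = a 0%N.
Proof.
move=> fa; apply/eqP; rewrite -subr_eq0; apply/eqP/eq0_normc/eqP.
rewrite eq_le normc_ge0 andbT; apply/ler_addgt0Pr => e e0.
have /fa /cvg_normcP /(_ _ e0)[N hN] : unit_disc (0 : R[i]).
  by change (normc (0 : R[i]) < 1); rewrite normc0.
have := hN _ (leqnn N); rewrite partial_sumE big_ord_recl expr0 mulr1 add0r.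
by rewrite big1 ?addr0 // => k _; rewrite exprS mul0r mulr0.
Qed.

Lemma power_series_coef f a m : abs_conv a -> power_expansion f a ->
  (f^`(m))%classic 0 = (m`!)%:R * a m.
Proof.
move=> ca fa; have [_ h] := power_series_derive1n m ca fa.
by rewrite (power_series_at0 h) iter_dseqE add0n ffactnn.
Qed.

Lemma geometric_sum_le (q : R) n : 0 <= q < 1 -> \sum_(k < n) q ^+ k <= (1 - q)^-1.
Proof.
move=> /andP[q0 q1]; have d0 : 0 < 1 - q by lra.
rewrite -[leRHS]mul1r ler_pdivlMr // mulrC -opprB mulNr -subrX1 opprB.
by have := exprn_ge0 n q0; lra.
Qed.

(** Abel's lemma: convergence in the disc entails absolute convergence. *)
Lemma power_expansion_abs_conv f a : power_expansion f a -> abs_conv a.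
Proof.
move=> fa r /andP[r0 r1]; pose rho := (1 + r) / 2.
have [rrho rho1] : r < rho /\ rho < 1 by rewrite /rho; split; lra.
have rho0 : 0 < rho by lra.
have nrho : normc (rho%:C : R[i]) = rho by rewrite normc_real gtr0_norm.
have /fa /cvg_normcP /(_ _ ltr01)[N hN] : unit_disc (rho%:C : R[i]).
  by change (normc (rho%:C : R[i]) < 1); rewrite nrho.
pose t k := normc (a k) * rho ^+ k.
have t0 k : 0 <= t k by rewrite mulr_ge0 ?normc_ge0 ?exprn_ge0 // ltW.
pose T := 2 + \sum_(k < N.+1) t k.
have T0 : 0 <= T by rewrite addr_ge0 //; apply: sumr_ge0.
have tT k : t k <= T.
  case: (ltnP k N.+1) => kN.
    rewrite /T (bigD1 (Ordinal kN)) //= addrCA lerDl addr_ge0 //.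
    by apply: sumr_ge0.
  case: k kN => [//|k]; rewrite ltnS => Nk.
  have -> : t k.+1 = normc (partial_sum a k.+1 rho%:C - partial_sum a k rho%:C).
    by rewrite !partial_sumE big_ord_recr /= addrAC subrr add0r normcM normcX nrho.
  apply: le_trans (normc_triangle _ (f rho%:C) _) _.
  rewrite normc_distC; have := hN _ Nk; have := hN _ (leqW Nk).
  have : 0 <= \sum_(k < N.+1) t k by apply: sumr_ge0.
  by rewrite /T; lra.
have q01 : 0 <= r / rho < 1.
  by rewrite divr_ge0 ?(ltW rho0) //= ltr_pdivrMr // mul1r.
exists (T * (1 - r / rho)^-1) => n.
apply: le_trans (ler_wpM2l T0 (geometric_sum_le n q01)).
rewrite mulr_sumr; apply: ler_sum => k _.
have -> : r ^+ k = rho ^+ k * (r / rho) ^+ k by rewrite -exprMn mulrC divfK // gt_eqF.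
by rewrite mulrA; apply: ler_wpM2r (tT k); rewrite exprn_ge0 //; case/andP: q01.
Qed.

Lemma power_expansion_unique f a b : power_expansion f a -> power_expansion f b ->
  forall m, a m = b m.
Proof.
move=> fa fb m.
have ha := power_series_coef m (power_expansion_abs_conv fa) fa.
have hb := power_series_coef m (power_expansion_abs_conv fb) fb.
have f0 : (m`!)%:R != 0 :> R[i] by rewrite pnatr_eq0 -lt0n fact_gt0.
by apply: (mulfI f0); rewrite -ha -hb.
Qed.

End PowerSeries.

(** * Universality of the series and failure for its derivative *)

Section Universality.
Variable R : realType.
Implicit Types (a c : R[i] ^nat) (b : nat -> R) (K : set R[i]) (e : R) (z : R[i]).

Lemma partial_sumS a n z :
  partial_sum a n.+1 z = partial_sum a n z + a n.+1 * z ^+ n.+1.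
Proof. by rewrite !partial_sumE big_ord_recr. Qed.

Lemma universal_on_arcs_series a : universal_on_arcs a -> universal_series a.
Proof.
move=> ua K phi cK KT KnT cphi.
have [zeta [d [zeta1 d0 Karc]]] := compact_proper_arc cK KT KnT.
have dense := poly_dense zeta1 d0 Karc cK cphi.
have /choice[F hF] : forall x : nat * nat, exists n : nat, (x.2 <= n)%N /\
    forall z, K z -> normc (partial_sum a n z - phi z) <= x.1.+1%:R^-1.
  move=> [m N] /=; have e0 : 0 < (m.+1%:R : R)^-1 / 2 by rewrite divr_gt0 ?invr_gt0 ?ltr0n.
  have [p hp] := dense _ e0.
  have [n Nn hn] := ua _ _ p _ N zeta1 d0 e0; exists n; split=> // z Kz.
  apply: le_trans (normc_triangle _ p.[z] _) _.
  have := hn _ (Karc _ Kz); have := hp _ Kz.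
  by set x := _^-1; lra.
pose lambda := fix lambda m : nat :=
  if m is m'.+1 then F (m, (lambda m').+1) else F (0%N, 0%N).
exists lambda.
  apply: homo_ltn; first by move=> ? ? ?; exact: ltn_trans.
  by move=> m /=; have [] := hF (m.+1, (lambda m).+1).
apply/cvgrPdist_le => e e0; have [J hJ] := inv_nat_small e0.
exists J => // m /= Jm; rewrite sub0r normrN.
have hm z : K z -> normc (partial_sum a (lambda m) z - phi z) <= e.
  move=> Kz; apply: le_trans (ltW (hJ m Jm)).
  by case: m {Jm} => [|m]; [have [_] := hF (0%N, 0%N)
                         |have [_] := hF (m.+1, (lambda m).+1)]; apply.
set A := [set _ | _ in K].
have [[z Kz]|nK] := pselect (exists z, K z); last first.
  suff -> : A = set0 by rewrite sup0 normr0 ltW.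
  by apply/seteqP; split=> // y [z Kz _]; apply: nK; exists z.
have Aub : ubound A e by move=> _ [w Kw <-]; exact: hm.
have Az : A (normc (partial_sum a (lambda m) z - phi z)) by exists z.
rewrite ger0_norm.
  by apply: ge_sup => //; exists (normc (partial_sum a (lambda m) z - phi z)).
by apply: le_trans (normc_ge0 _) (ub_le_sup _ Az); exists e.
Qed.

Section Telescope.
Variables (c : R[i] ^nat) (b : nat -> R).
Hypothesis cb : forall k, normc (c k.+1) <= b k - b k.+1.

Lemma partial_sum_telescope N n z : normc z = 1 -> (N <= n)%N ->
  normc (partial_sum c n z - partial_sum c N z) <= b N - b n.
Proof.
move=> z1 /subnK <-; elim: (n - N)%N => [|t IH].
  by rewrite add0n !subrr normc0.
rewrite addSn partial_sumS addrAC; apply: le_trans (normcD_le _ _) _.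
rewrite normcM normcX z1 expr1n mulr1.
by have := cb (t + N); lra.
Qed.

Lemma sum_telescope n : \sum_(k < n) normc (c k.+1) <= b 0%N - b n.
Proof.
elim: n => [|n IH]; first by rewrite big_ord0 subrr.
by rewrite big_ord_recr /=; have := cb n; lra.
Qed.

Hypothesis b_small : forall e, 0 < e -> exists N : nat, forall n, (N <= n)%N -> 0 <= b n <= e.

Lemma telescope_abs_conv : c 0%N = 0 -> abs_conv c.
Proof.
move=> c0 r /andP[r0 r1]; exists (b 0%N) => n.
apply: (@le_trans _ _ (\sum_(k < n) normc (c k))).
  apply: ler_sum => k _; rewrite ler_piMr ?normc_ge0 //.
  by rewrite exprn_ile1 // ltW.
have [N hN] := b_small ltr01.
have b0 : 0 <= b n.
  have : b (n + N)%N <= b n.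
    elim: N {hN} => [|N IH]; first by rewrite addn0.
    by rewrite addnS; apply: le_trans IH; have := cb (n + N); have := normc_ge0 (c (n + N).+1); lra.
  by have /andP[h _] := hN (n + N)%N (leq_addl _ _); exact: le_trans.
case: n b0 => [|n] b0; first by rewrite big_ord0.
rewrite big_ord_recl c0 normc0 add0r.
apply: le_trans (sum_telescope n) _; rewrite lerBlDr lerDl.
by apply: le_trans b0 _; have := cb n; have := normc_ge0 (c n.+1); lra.
Qed.

(** Adding to a universal series a series converging uniformly on the circle
    preserves universality: the targets are shifted by a partial sum. *)
Lemma universal_on_arcs_add a :
  universal_on_arcs a -> universal_on_arcs (fun k => a k + c k).
Proof.
move=> ua zeta d p e N zeta1 d0 e0; have e2 : 0 < e / 2 by lra.
have [N0 hN0] := b_small e2.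
pose q := p - \poly_(k < N0.+1) c k.
have [n Nn hn] := ua _ _ q _ (maxn N N0) zeta1 d0 e2.
move: Nn; rewrite geq_max => /andP[Nn N0n]; exists n => // z Ez.
have z1 : normc z = 1 by case: Ez.
have -> : partial_sum (fun k => a k + c k) n z - p.[z] =
    (partial_sum a n z - q.[z]) + (partial_sum c n z - partial_sum c N0 z).
  rewrite /q hornerD hornerN horner_poly -partial_sumE.
  suff -> : partial_sum (fun k => a k + c k) n z = partial_sum a n z + partial_sum c n z.
    by ring.
  by rewrite !partial_sumE -big_split; apply: eq_bigr => k _; rewrite mulrDl.
apply: le_trans (normcD_le _ _) _.
have := hn _ Ez; have := partial_sum_telescope z1 N0n.
have /andP[_ h1] := hN0 _ (leqnn N0); have /andP[h2 _] := hN0 _ N0n.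
lra.
Qed.

End Telescope.

Lemma abs_convD a c : abs_conv a -> abs_conv c -> abs_conv (fun k => a k + c k).
Proof.
move=> ha hc r r01; have [B hB] := ha r r01; have [B' hB'] := hc r r01.
exists (B + B') => n; apply: le_trans (lerD (hB n) (hB' n)).
rewrite -big_split; apply: ler_sum => k _ /=; rewrite -mulrDl.
by rewrite ler_wpM2r ?normcD_le // exprn_ge0 //; case/andP: r01.
Qed.

(** The value at 1 of the partial sums of the [l]-th derived series. *)
Lemma partial_sum_dseq1 a l n : partial_sum (iter l (@dseq R) a) n 1 =
  \sum_(k < (n + l).+1) (k ^_ l)%:R * a k.
Proof.
rewrite partial_sumE -[RHS](big_mkord xpredT (fun k => (k ^_ l)%:R * a k)).
rewrite (big_cat_nat (n := l)) //=; last by rewrite leqW // leq_addl.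
have -> : \sum_(0 <= k < l) (k ^_ l)%:R * a k = 0.
  by rewrite big_mkord big1 // => k _; rewrite ffact_small ?mul0r.
rewrite add0r -{2}[l]add0n big_addn -addSn addnK big_mkord.
by apply: eq_bigr => k _; rewrite expr1n mulr1 iter_dseqE.
Qed.

Lemma not_universal_at1 a N : (forall n, (N <= n)%N -> 1 <= normc (partial_sum a n 1)) ->
  ~ universal_series a.
Proof.
move=> hN /(_ [set 1] (fun=> 0)) [].
- exact: compact_set1.
- by move=> _ ->; exact: normc1.
- move=> h; have : (unit_circle : set R[i]) (-1).
    by change (normc (-1 : R[i]) = 1); rewrite normc_opp normc1.
  rewrite -h /= => /eqP; rewrite -subr_eq0 -opprD oppr_eq0.
  by rewrite -mulr2n pnatr_eq0.
- by apply: continuous_subspaceT => x; exact: cst_continuous.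
move=> lambda lhomo.
have lge m : (m <= lambda m)%N.
  elim: m => [//|m IH]; apply: leq_ltn_trans IH _; exact: lhomo.
have h2 : 0 < (1 / 2 : R) by lra.
move/cvgrPdist_le => /(_ _ h2)[M _ hM].
have := hM (M + N)%N (leq_addr _ _).
rewrite /= image_set1 sup1 subr0 sub0r normrN ger0_norm ?normc_ge0 //.
have := hN (lambda (M + N)%N) (leq_trans (leq_addl M N) (lge _)).
lra.
Qed.

End Universality.

Theorem theorem4p3 (R : realType) (l : nat) (hl : (1 <= l)%N) :
  exists f : R[i] -> R[i], in_U f /\ ~ in_U (f^`(l))%classic.
Proof.
have [a0 [conv0 univ0]] := universal_on_arcs_exists R.
have [c [b [c0 cb b_small [N hN]]]] := avoid_zero a0 hl.
pose a : R[i] ^nat := fun k => a0 k + c k.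
have conv_a : abs_conv a.
  exact: abs_convD conv0 (telescope_abs_conv cb b_small c0).
have /choice[f hf] : forall z : R[i], exists s : R[i],
    unit_disc z -> partial_sum a ^~ z @ \oo --> s.
  move=> z; have [z1|nz] := pselect (unit_disc z); last by exists 0.
  by have [s hs] := abs_conv_cvg conv_a z1; exists s.
have fa : power_expansion f a by move=> z; exact: hf.
exists f; split.
  split; first by move=> z z1; have [] := power_series_derive conv_a fa z1.
  exists a => //; apply: universal_on_arcs_series.
  exact (universal_on_arcs_add cb b_small univ0).
case=> _ [a' fa' univ'].
have [_ fl] := power_series_derive1n l conv_a fa.
have a'E : a' = iter l (@dseq R) a.
  by apply/funext; exact: power_expansion_unique fa' fl.
apply: (@not_universal_at1 _ a' N) univ' => n Nn.
by rewrite a'E partial_sum_dseq1; apply: hN; rewrite (leq_trans Nn) ?leq_addr.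
Qed.
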